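(* Let $0<r_1<r_2$, $N\ge 2$, and let $h:[r_1,r_2]\times[0,\infty)\to[0,\infty)$ be continuous with $h(t,0)=0$. Let $q$ and $f$ be defined from $h$ as in the context, and consider, for $\lambda>0$, the boundary value problem $$u''(t)+\lambda q(t)f(t,u(t))=0,\quad t\in(0,1),\qquad u(0)=0=u(1). \qquad (P_\lambda)$$ Assume there exist a continuous function $b:[0,1]\to[0,\infty)$, not identically zero, and positive constants $c,\delta,R$ with $c>1$ and $0<\delta<R$ such that (i) $f(t,u)\le b(t)u$ for all $u\ge R$, uniformly in $t\in(0,1)$, and (ii) $f(t,u)\ge c\,b(t)u$ for all $u\in(0,\delta)$, uniformly in $t\in(0,1)$. Then $(P_\lambda)$ has a positive solution for every $\lambda$ with $\frac{\lambda_{1,qb}}{c}<\lambda<\lambda_{1,qb}$.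
   Context: The problem $(P_\lambda)$ arises from radial solutions of $-\Delta v=\lambda h(|x|,v)$ in the annulus $\{x\in\mathbb{R}^N: r_1<|x|<r_2\}$, $v=0$ on the boundary. The functions $q$ and $f$ are defined as follows. If $N=2$: $q(t)=\left[r_2\left(\frac{r_1}{r_2}\right)^t\log\frac{r_2}{r_1}\right]^2$ and $f(t,u)=h\!\left(r_2\left(\frac{r_1}{r_2}\right)^t,u\right)$. If $N\ge 3$: with $A=\frac{(r_1r_2)^{N-2}}{r_2^{N-2}-r_1^{N-2}}$ and $B=\frac{r_2^{N-2}}{r_2^{N-2}-r_1^{N-2}}$, $q(t)=(N-2)^{-2}\frac{A^{2/(N-2)}}{(B-t)^{2(N-1)/(N-2)}}$ and $f(t,u)=h\!\left(\left(\frac{A}{B-t}\right)^{1/(N-2)},u\right)$. In either case $q$ is continuous on $[0,1]$ and bounded between positive constants there. A positive solution of $(P_\lambda)$ is a function $u\in C([0,1])\cap C^2(0,1)$ satisfying $(P_\lambda)$ with $u(t)>0$ for $t\in(0,1)$. For a continuous $m:[0,1]\to[0,\infty)$ that is positive on a set of positive measure, $\lambda_{1,m}$ denotes the first (smallest) eigenvalue of $-u''=\lambda m(t)u$ on $(0,1)$, $u(0)=u(1)=0$; its eigenfunction $\phi_{1,m}$ satisfies $\phi_{1,m}>0$ on $(0,1)$. Here $\lambda_{1,qb}$ is this eigenvalue with $m=qb$. *)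

(* Defs.v *)
From Stdlib Require Import Reals Lra.
From Coquelicot Require Import Coquelicot.
Open Scope R_scope.

Definition cont_on (D : R -> Prop) (g : R -> R) : Prop :=
  forall x, D x -> forall eps, 0 < eps -> exists del, 0 < del /\
    forall y, D y -> Rabs (y - x) < del -> Rabs (g y - g x) < eps.

Definition cont_on2 (D : R -> R -> Prop) (g : R -> R -> R) : Prop :=
  forall x u, D x u -> forall eps, 0 < eps -> exists del, 0 < del /\
    forall y v, D y v -> Rabs (y - x) < del -> Rabs (v - u) < del ->
      Rabs (g y v - g x u) < eps.

Definition closed01 (t : R) : Prop := 0 <= t <= 1.
Definition open01 (t : R) : Prop := 0 < t < 1.

Definition C2_open01 (u u2 : R -> R) : Prop :=
  exists u1 : R -> R, forall t, open01 t ->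
    is_derive u t (u1 t) /\ is_derive u1 t (u2 t) /\ continuous u2 t.

(* The weight q from the paper (change of variables on the annulus). *)
Definition qfun (N : nat) (r1 r2 : R) (t : R) : R :=
  if (N =? 2)%nat then
    (r2 * Rpower (r1 / r2) t * ln (r2 / r1)) ^ 2
  else
    let A := (r1 * r2) ^ (N - 2) / (r2 ^ (N - 2) - r1 ^ (N - 2)) in
    let B := r2 ^ (N - 2) / (r2 ^ (N - 2) - r1 ^ (N - 2)) in
    / (INR (N - 2)) ^ 2 * Rpower A (2 / INR (N - 2))
      / Rpower (B - t) (2 * INR (N - 1) / INR (N - 2)).

Definition ffun (N : nat) (r1 r2 : R) (h : R -> R -> R) (t u : R) : R :=
  if (N =? 2)%nat then
    h (r2 * Rpower (r1 / r2) t) u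
  else
    let A := (r1 * r2) ^ (N - 2) / (r2 ^ (N - 2) - r1 ^ (N - 2)) in
    let B := r2 ^ (N - 2) / (r2 ^ (N - 2) - r1 ^ (N - 2)) in
    h (Rpower (A / (B - t)) (/ INR (N - 2))) u.

Definition is_eigenvalue (m : R -> R) (lam : R) : Prop :=
  exists u u2 : R -> R,
    cont_on closed01 u /\ C2_open01 u u2 /\ u 0 = 0 /\ u 1 = 0 /\
    (exists t, closed01 t /\ u t <> 0) /\
    (forall t, open01 t -> - u2 t = lam * m t * u t).

Definition is_first_eigenvalue (m : R -> R) (lam : R) : Prop :=
  is_eigenvalue m lam /\ forall mu, is_eigenvalue m mu -> lam <= mu.

Definition positive_solution (q : R -> R) (f : R -> R -> R) (lam : R) (u : R -> R) : Prop :=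
  exists u2 : R -> R,
    cont_on closed01 u /\ C2_open01 u u2 /\ u 0 = 0 /\ u 1 = 0 /\
    (forall t, open01 t -> 0 < u t) /\
    (forall t, open01 t -> u2 t + lam * q t * f t (u t) = 0).

(* Main.v *)
Require Import Defs.
From Stdlib Require Import Reals Lra Lia ClassicalEpsilon.
From Coquelicot Require Import Coquelicot.
Open Scope R_scope.

(** The minimal Dirichlet eigenvalue [lam1] of the weight [m = q b] has a positive
    eigenfunction [phi]: follow the solution of the initial value problem
    [y'' + l m y = 0], [y(0) = 0], [y'(0) = 1] as [l] grows from [0]; by concavity it can
    only lose positivity on (0,1] through a zero at [1], and then [l] is an eigenvalue.

    For [lam1 / c < lam < lam1] a small multiple of [phi] is a subsolution, by (ii), and a
    large multiple of [phi + eps (1 + sqrt (t (1 - t)))] is a strict supersolution, by (i).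
    As the nonlinearity is only continuous, it is approximated from above by its
    sup-convolutions, which are Lipschitz and decrease. For each of them monotone iteration
    from the preceding solution gives a smaller solution above the subsolution, so the
    solutions decrease; being uniformly Lipschitz, they converge uniformly. *)

(** Approximating from above makes the scheme monotone: the subsolution serves every approximate
    problem and each solution is a supersolution of the next one, so pointwise limits exist by
    monotonicity alone. The price is an excess over the nonlinearity, at most 1 from some index on,
    and this is why the supersolution has to be strict. Strictness is the obstacle: [b] may vanish
    on intervals and [phi] vanishes at 0 and 1, so the margin [(lam1 - lam) m phi] has no positive
    lower bound; the concave square root term supplies one. The definition of the first eigenvalue
    gives minimality only, so the positivity of an eigenfunction has to be derived. Only values
    between the sub- and the supersolution matter; clamping both arguments to compact intervals
    makes the nonlinearity bounded and uniformly continuous on the whole plane. *)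

(** * Clamping, continuity and a maximum principle *)

Definition clamp (a b t : R) : R := Rmax a (Rmin b t).

Lemma clamp_in a b t : a <= b -> a <= clamp a b t <= b.
Proof. intros H; unfold clamp, Rmax, Rmin; repeat destruct Rle_dec; lra. Qed.

Lemma clamp_id a b t : a <= t <= b -> clamp a b t = t.
Proof. intros H; unfold clamp, Rmax, Rmin; repeat destruct Rle_dec; lra. Qed.

Lemma clamp_lip a b t s : a <= b -> Rabs (clamp a b t - clamp a b s) <= Rabs (t - s).
Proof.
  intros H; unfold clamp, Rmax, Rmin; repeat destruct Rle_dec;
  unfold Rabs; repeat destruct Rcase_abs; lra.
Qed.

Lemma continuous_eps (f : R -> R) x :
  continuous f x <->
  forall eps, 0 < eps -> exists d, 0 < d /\
    forall y, Rabs (y - x) < d -> Rabs (f y - f x) < eps.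
Proof.
  split.
  - intros H eps He.
    destruct (proj1 (filterlim_locally f (f x)) H (mkposreal eps He)) as [d Hd].
    exists d; split; [apply cond_pos|]. exact Hd.
  - intros H. apply filterlim_locally. intros eps.
    destruct (H eps (cond_pos eps)) as [d [Hd K]].
    exists (mkposreal d Hd). exact K.
Qed.

Lemma continuous_pt (f : R -> R) x : continuous f x -> continuity_pt f x.
Proof. intros H; apply continuity_pt_filterlim; exact H. Qed.

(** Freezing [f] outside the interval turns relative continuity into continuity on the line, so
    later arguments need no one-sided limits at the end points. *)
Lemma continuous_clamp (f : R -> R) (a b : R) : a <= b ->
  cont_on (fun t => a <= t <= b) f -> forall t, continuous (fun s => f (clamp a b s)) t.
Proof.
  intros Hab Hf t. apply continuous_eps. intros eps He.
  destruct (Hf (clamp a b t) (clamp_in a b t Hab) eps He) as [d [Hd K]].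
  exists d; split; [exact Hd|]. intros y Hy. apply K.
  - apply clamp_in, Hab.
  - eapply Rle_lt_trans; [apply clamp_lip, Hab|exact Hy].
Qed.

(** The product form covers both sides of [x] at once. *)
Lemma derive_pos_increasing (f : R -> R) x l :
  is_derive f x l -> 0 < l ->
  exists d, 0 < d /\ forall y, 0 < Rabs (y - x) < d -> 0 < (f y - f x) * (y - x).
Proof.
  intros H Hl. apply is_derive_Reals in H.
  destruct (H (l / 2)) as [d Hd]; [lra|].
  exists d; split; [apply cond_pos|]. intros y [Hy1 Hy2].
  assert (Hne : y - x <> 0) by (intros E; rewrite E, Rabs_R0 in Hy1; lra).
  specialize (Hd (y - x) Hne Hy2).
  replace (x + (y - x)) with y in Hd by ring.
  apply Rabs_def2 in Hd.
  assert (Hq : 0 < (f y - f x) / (y - x)) by lra.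
  replace ((f y - f x) * (y - x)) with ((f y - f x) / (y - x) * (y - x) ^ 2) by (field; exact Hne).
  apply Rmult_lt_0_compat; [exact Hq|]. apply pow2_gt_0, Hne.
Qed.

(** At a positive interior maximum [x] the first derivative vanishes and [D2 x > 0], so [D1] is
    positive just to the right of [x] and [D] would still grow there. *)
Lemma max_principle (D D1 D2 : R -> R) :
  (forall t, continuous D t) ->
  (forall t, open01 t -> is_derive D t (D1 t) /\ is_derive D1 t (D2 t)) ->
  D 0 <= 0 -> D 1 <= 0 ->
  (forall t, open01 t -> 0 < D t -> 0 < D2 t) ->
  forall t, closed01 t -> D t <= 0.
Proof.
  intros Hc Hd H0 H1 H2 t Ht.
  destruct (continuity_ab_maj D 0 1) as [x [Hx Hx01]]; [lra|intros; apply continuous_pt, Hc|].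
  destruct (Rle_or_lt (D x) 0) as [Hle|Hpos].
  { specialize (Hx t Ht); lra. }
  assert (Hxo : open01 x).
  { unfold open01. split; apply Rnot_le_lt; intros E.
    - assert (x = 0) by lra; subst; lra.
    - assert (x = 1) by lra; subst; lra. }
  destruct (Hd x Hxo) as [HD HD1].
  pose proof Hxo as [Hxl Hxr].
  assert (near : forall d, 0 < d -> exists e, 0 < e < d /\ e < x /\ e < 1 - x).
  { intros d Hdp. exists (Rmin (d/2) (Rmin (x/2) ((1-x)/2))).
    unfold Rmin; repeat destruct Rle_dec; lra. }
  assert (E1 : D1 x = 0).
  { destruct (Rtotal_order (D1 x) 0) as [Hn|[He|Hp]]; [exfalso|exact He|exfalso].
    - destruct (derive_pos_increasing (fun s => - D s) x (- D1 x)) as [d [Hdp K]].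
      { apply (is_derive_opp D), HD. } { lra. }
      destruct (near d Hdp) as [e [He1 [He2 He3]]].
      specialize (K (x - e)). replace (x - e - x) with (- e) in K by ring.
      rewrite Rabs_Ropp, Rabs_pos_eq in K by lra.
      specialize (K ltac:(lra)). specialize (Hx (x - e) ltac:(lra)). nra.
    - destruct (derive_pos_increasing D x (D1 x) HD Hp) as [d [Hdp K]].
      destruct (near d Hdp) as [e [He1 [He2 He3]]].
      specialize (K (x + e)). replace (x + e - x) with e in K by ring.
      rewrite Rabs_pos_eq in K by lra.
      specialize (K ltac:(lra)). specialize (Hx (x + e) ltac:(lra)). nra. }
  exfalso.
  destruct (derive_pos_increasing D1 x (D2 x) HD1 (H2 x Hxo Hpos)) as [d [Hdp K]].
  destruct (near d Hdp) as [e [He1 [He2 He3]]].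
  destruct (MVT_cor2 D D1 x (x + e)) as [c [Hc1 Hc2]]; [lra| |].
  { intros c Hcc. apply is_derive_Reals. apply Hd. unfold open01; lra. }
  specialize (K c). rewrite Rabs_pos_eq in K by lra. specialize (K ltac:(lra)).
  specialize (Hx (x + e) ltac:(lra)). rewrite E1 in K.
  assert (0 < D1 c) by nra. nra.
Qed.

(** * Linear Dirichlet problems *)

(** This is [-u'' = g] with zero Dirichlet data. The derivatives are two-sided even at 0 and 1, so
    the mean value theorem applies up to the boundary. *)
Definition solves (u g : R -> R) : Prop :=
  (forall t, continuous u t) /\ u 0 = 0 /\ u 1 = 0 /\
  exists u1, forall t, closed01 t -> is_derive u t (u1 t) /\ is_derive u1 t (- g t).

Lemma derive_bound_lip (u u1 : R -> R) P :
  (forall t, closed01 t -> is_derive u t (u1 t)) ->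
  (forall t, closed01 t -> Rabs (u1 t) <= P) ->
  forall t s, closed01 t -> closed01 s -> Rabs (u t - u s) <= P * Rabs (t - s).
Proof.
  intros Hd HP.
  assert (K : forall t s, closed01 t -> closed01 s -> s < t ->
    Rabs (u t - u s) <= P * Rabs (t - s)).
  { intros t s [Ht1 Ht2] [Hs1 Hs2] Hlt.
    destruct (MVT_cor2 u u1 s t Hlt) as [c [Hc1 Hc2]].
    { intros c Hc. apply is_derive_Reals, Hd. unfold closed01; lra. }
    rewrite Hc1, Rabs_mult. apply Rmult_le_compat_r; [apply Rabs_pos|].
    apply HP. unfold closed01; lra. }
  intros t s Ht Hs. destruct (Rtotal_order s t) as [H|[H|H]].
  - apply K; assumption.
  - subst. rewrite !Rminus_diag, Rabs_R0. lra.
  - rewrite (Rabs_minus_sym (u t)), (Rabs_minus_sym t). apply K; assumption.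
Qed.

(** By Rolle [u1] vanishes at some [c]; as [u1] is [P]-Lipschitz on an interval of length 1, it is
    bounded by [P]. *)
Lemma solves_lip (u g : R -> R) P :
  solves u g -> (forall t, closed01 t -> Rabs (g t) <= P) ->
  forall t s, closed01 t -> closed01 s -> Rabs (u t - u s) <= P * Rabs (t - s).
Proof.
  intros [Hc [H0 [H1 [u1 Hu]]]] HP.
  assert (HP0 : 0 <= P).
  { eapply Rle_trans; [apply Rabs_pos|apply (HP 0)]. unfold closed01; lra. }
  apply derive_bound_lip with u1; [intros t Ht; apply Hu, Ht|].
  destruct (MVT_cor2 u u1 0 1) as [c [Hc1 Hc2]]; [lra| |].
  { intros c Hcc. apply is_derive_Reals, Hu. unfold closed01; lra. }
  assert (E : u1 c = 0) by lra.
  intros t Ht.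
  assert (Hcc : closed01 c) by (unfold closed01; lra).
  replace (u1 t) with (u1 t - u1 c) by lra.
  eapply Rle_trans.
  - apply (derive_bound_lip u1 (fun t => - g t) P); try assumption.
    + intros; apply Hu; assumption.
    + intros; rewrite Rabs_Ropp; apply HP; assumption.
  - rewrite <- (Rmult_1_r P) at 2. apply Rmult_le_compat_l; [exact HP0|].
    unfold closed01 in *. apply Rabs_le; lra.
Qed.

Lemma solves_bound (u g : R -> R) P :
  solves u g -> (forall t, closed01 t -> Rabs (g t) <= P) ->
  forall t, closed01 t -> Rabs (u t) <= P.
Proof.
  intros Hu HP t Ht.
  assert (HP0 : 0 <= P).
  { eapply Rle_trans; [apply Rabs_pos|apply (HP 0)]. unfold closed01; lra. }
  assert (H := solves_lip u g P Hu HP t 0 Ht ltac:(unfold closed01; lra)).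
  destruct Hu as [_ [H0 _]]. rewrite H0, !Rminus_0_r in H.
  eapply Rle_trans; [exact H|].
  unfold closed01 in Ht. rewrite Rabs_pos_eq by lra. nra.
Qed.

Lemma solves_minus (u g v k : R -> R) :
  solves u g -> solves v k -> solves (fun t => u t - v t) (fun t => g t - k t).
Proof.
  intros [Hc [H0 [H1 [u1 Hu]]]] [Kc [K0 [K1 [v1 Hv]]]].
  split; [|split; [|split]]; try lra.
  - intros t. apply (continuous_minus u v); auto.
  - exists (fun t => u1 t - v1 t). intros t Ht.
    destruct (Hu t Ht) as [A1 A2], (Hv t Ht) as [B1 B2]. split.
    + apply (is_derive_minus u v); assumption.
    + replace (- (g t - k t)) with (minus (- g t) (- k t)) by (unfold minus, plus, opp; simpl; ring).
      apply (is_derive_minus u1 v1); assumption.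
Qed.

Lemma is_derive_continuous (f : R -> R) x l : is_derive f x l -> continuous f x.
Proof. intros H. exact (ex_derive_continuous f x (ex_intro _ l H)). Qed.

Lemma is_derive_primitive (g : R -> R) :
  (forall t, continuous g t) -> forall t, is_derive (fun x => RInt g 0 x) t (g t).
Proof.
  intros Hg t. apply (is_derive_RInt g (fun x => RInt g 0 x) 0); [|apply Hg].
  apply filter_forall. intros x. apply (RInt_correct (V := R_CompleteNormedModule)).
  apply (ex_RInt_continuous (V := R_CompleteNormedModule)). intros; apply Hg.
Qed.

Ltac ex_derive_hyp :=
  repeat match goal with
  | |- _ /\ _ => split
  | |- True => exact I
  | H : forall t, is_derive ?f t _ |- ex_derive ?f ?x => exact (ex_intro _ _ (H x))
  | H : forall t, is_derive ?f t _ |- ex_derive (fun y => ?f y) ?x => exact (ex_intro _ _ (H x))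
  end.

Ltac derive_hyp :=
  repeat match goal with
  | H : forall t, is_derive ?f t _ |- context [Derive ?g ?x] =>
      replace (Derive g x) with (Derive f x) by reflexivity;
      rewrite (is_derive_unique f x _ (H x))
  end.

Lemma poisson_solution (g : R -> R) :
  (forall t, continuous g t) -> exists w, solves w g.
Proof.
  intros Hg.
  set (p := fun x : R => RInt g 0 x : R).
  set (P := fun x : R => RInt p 0 x : R).
  assert (Dp : forall t, is_derive p t (g t)) by (apply is_derive_primitive, Hg).
  assert (DP : forall t, is_derive P t (p t)).
  { apply is_derive_primitive. intros t. eapply is_derive_continuous, Dp. }
  assert (P0 : P 0 = 0) by exact (RInt_point (V := R_CompleteNormedModule) 0 p).
  assert (Dw : forall t, is_derive (fun t => P 1 * t - P t) t (P 1 - p t)).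
  { intros t. auto_derive; [ex_derive_hyp|].
    derive_hyp; ring. }
  exists (fun t => P 1 * t - P t). split; [|split; [|split]].
  - intros t. eapply is_derive_continuous, Dw.
  - rewrite P0; ring.
  - ring.
  - exists (fun t => P 1 - p t). intros t _. split; [apply Dw|].
    auto_derive; [ex_derive_hyp|].
    derive_hyp; ring.
Qed.

Lemma helmholtz_solution (k : R) (g : R -> R) : 0 < k ->
  (forall t, continuous g t) ->
  exists w, solves w (fun t => g t - k * w t).
Proof.
  intros Hk Hg.
  set (o := sqrt k).
  assert (Ho : 0 < o) by (apply sqrt_lt_R0, Hk).
  assert (Hoo : o * o = k) by (apply sqrt_sqrt; lra).
  set (p := fun x : R => RInt (fun s => exp (- o * s) * g s) 0 x : R).
  set (r := fun x : R => RInt (fun s => exp (o * s) * g s) 0 x : R).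
  assert (Cexp : forall a t, continuous (fun s => exp (a * s)) t).
  { intros a t. apply (is_derive_continuous _ _ (a * exp (a * t))).
    auto_derive; [exact I|ring]. }
  assert (Dp : forall t, is_derive p t (exp (- o * t) * g t)).
  { apply is_derive_primitive. intros t.
    apply (continuous_mult (fun s => exp (- o * s)) g); auto. }
  assert (Dr : forall t, is_derive r t (exp (o * t) * g t)).
  { apply is_derive_primitive. intros t.
    apply (continuous_mult (fun s => exp (o * s)) g); auto. }
  (* Variation of constants: [z t] is [-(1/o)] times the integral of [sinh (o (t - s)) g s] over
     [[0,t]], with the kernel split into exponentials so that [t] leaves the integrand. *)
  set (z := fun t => - / (2 * o) * (exp (o * t) * p t - exp (- o * t) * r t)).
  set (z1 := fun t => - / 2 * (exp (o * t) * p t + exp (- o * t) * r t)).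
  assert (EE : forall t, exp (o * t) * exp (- o * t) = 1).
  { intros t. rewrite <- exp_plus. replace (o * t + - o * t) with 0 by ring. apply exp_0. }
  assert (Dz : forall t, is_derive z t (z1 t)).
  { intros t. unfold z, z1. auto_derive.
    - ex_derive_hyp.
    - derive_hyp; field; lra. }
  assert (Dz1 : forall t, is_derive z1 t (k * z t - g t)).
  { intros t. unfold z, z1. auto_derive.
    - ex_derive_hyp.
    - derive_hyp.
      transitivity (- / 2 * o * (exp (o * t) * p t - exp (- o * t) * r t)
        - (exp (o * t) * exp (- o * t)) * g t); [field|].
      rewrite EE, <- Hoo. field. lra. }
  (* [S t = 2 sinh (o t)] solves the homogeneous equation and vanishes at 0; subtracting a multiple
     of it corrects the value at 1. *)
  set (S := fun t => exp (o * t) - exp (- o * t)).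
  set (S1 := fun t => o * (exp (o * t) + exp (- o * t))).
  assert (DS : forall t, is_derive S t (S1 t)).
  { intros t. unfold S, S1. auto_derive; [exact I|ring]. }
  assert (DS1 : forall t, is_derive S1 t (k * S t)).
  { intros t. unfold S, S1. auto_derive; [exact I|rewrite <- Hoo; ring]. }
  assert (HS : 0 < S 1).
  { unfold S. apply Rlt_0_minus, exp_increasing. lra. }
  set (a := z 1 / S 1).
  assert (Dw : forall t, is_derive (fun t => z t - a * S t) t (z1 t - a * S1 t)).
  { intros t. auto_derive; [ex_derive_hyp|].
    derive_hyp; ring. }
  assert (Cw : forall t, continuous (fun t => z t - a * S t) t).
  { intros t. eapply is_derive_continuous, Dw. }
  exists (fun t => z t - a * S t). split; [exact Cw|]. split; [|split].
  - assert (z 0 = 0).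
    { unfold z, p, r. rewrite !(RInt_point (V := R_CompleteNormedModule)). unfold zero; simpl. ring. }
    rewrite H. unfold S. rewrite !Rmult_0_r. ring.
  - unfold a. field. lra.
  - exists (fun t => z1 t - a * S1 t). intros t _. split; [apply Dw|].
    auto_derive; [ex_derive_hyp|].
    derive_hyp; ring.
Qed.

(** * Sub- and supersolutions *)

(** The invariant [A n] is carried in a subset type, since the next term exists only for terms that
    satisfy it. *)
Lemma dependent_choice (X : Type) (A : nat -> X -> Prop) (Rel : nat -> X -> X -> Prop) (x0 : X) :
  A 0%nat x0 -> (forall n x, A n x -> exists y, A (S n) y /\ Rel n x y) ->
  exists s : nat -> X, s 0%nat = x0 /\ forall n, A n (s n) /\ Rel n (s n) (s (S n)).
Proof.
  intros H0 HS.
  assert (step : forall n (x : {x | A n x}), {y : {y | A (S n) y} | Rel n (proj1_sig x) (proj1_sig y)}).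
  { intros n [x Hx]. destruct (constructive_indefinite_description _ (HS n x Hx)) as [y [Hy HR]].
    exists (exist _ y Hy). exact HR. }
  set (s := nat_rect (fun n => {x | A n x}) (exist _ x0 H0) (fun n x => proj1_sig (step n x))).
  exists (fun n => proj1_sig (s n)). split; [reflexivity|].
  intros n. split; [exact (proj2_sig (s n))|].
  exact (proj2_sig (step n (s n))).
Qed.

(** Three-epsilon argument: convergence at the finitely many nodes [i / m] is uniform, and the
    common Lipschitz constant controls the rest once [P / m < eps / 3]. *)
Lemma equi_lip_uniform (v : nat -> R -> R) (u : R -> R) P :
  (forall n t s, closed01 t -> closed01 s -> Rabs (v n t - v n s) <= P * Rabs (t - s)) ->
  (forall t, closed01 t -> is_lim_seq (fun n => v n t) (u t)) ->
  forall eps, 0 < eps -> exists N, forall n, (N <= n)%nat ->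
    forall t, closed01 t -> Rabs (v n t - u t) < eps.
Proof.
  intros Hv Hu eps He.
  assert (HP : 0 <= P).
  { specialize (Hv 0%nat 1 0 ltac:(unfold closed01; lra) ltac:(unfold closed01; lra)).
    rewrite Rminus_0_r, Rabs_R1 in Hv. pose proof (Rabs_pos (v 0%nat 1 - v 0%nat 0)). lra. }
  assert (Lu : forall t s, closed01 t -> closed01 s -> Rabs (u t - u s) <= P * Rabs (t - s)).
  { intros t s Ht Hs.
    apply (is_lim_seq_le (fun n => Rabs (v n t - v n s)) (fun _ => P * Rabs (t - s))
       (Rabs (u t - u s)) (P * Rabs (t - s))).
    - intros n; apply Hv; assumption.
    - apply (is_lim_seq_abs _ (u t - u s)).
      apply is_lim_seq_minus'; apply Hu; assumption.
    - apply is_lim_seq_const. }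
  destruct (archimed_cor1 (eps / (3 * (P + 1)))) as [m [Hm1 Hm2]].
  { apply Rdiv_lt_0_compat; lra. }
  assert (Hm : 0 < INR m) by (apply lt_0_INR; lia).
  assert (Hm3 : P * / INR m < eps / 3).
  { apply Rmult_lt_compat_l with (r := P + 1) in Hm1; [|lra].
    replace ((P + 1) * (eps / (3 * (P + 1)))) with (eps / 3) in Hm1 by (field; lra).
    pose proof (Rinv_0_lt_compat _ Hm). nra. }
  assert (grid : forall k, (k <= m)%nat -> exists N, forall n i, (N <= n)%nat -> (i <= k)%nat ->
    Rabs (v n (INR i / INR m) - u (INR i / INR m)) < eps / 3).
  { assert (pt : forall k, (k <= m)%nat -> exists N, forall n, (N <= n)%nat ->
      Rabs (v n (INR k / INR m) - u (INR k / INR m)) < eps / 3).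
    { intros k Hk.
      assert (Hc : closed01 (INR k / INR m)).
      { split; [apply Rdiv_le_0_compat; [apply pos_INR|exact Hm]|].
        apply Rle_div_l; [exact Hm|]. rewrite Rmult_1_l. apply le_INR, Hk. }
      specialize (Hu _ Hc). apply is_lim_seq_spec in Hu.
      destruct (Hu (mkposreal (eps / 3) ltac:(lra))) as [N HN]. exists N. exact HN. }
    induction k as [|k IH]; intros Hk.
    - destruct (pt 0%nat Hk) as [N HN]. exists N. intros n i Hn Hi.
      replace i with 0%nat by lia. apply HN, Hn.
    - destruct (pt (S k) Hk) as [N1 HN1]. destruct IH as [N2 HN2]; [lia|].
      exists (N1 + N2)%nat. intros n i Hn Hi.
      destruct (Nat.eq_dec i (S k)) as [->|Hne]; [apply HN1; lia|apply HN2; lia]. }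
  destruct (grid m (le_n m)) as [N HN]. exists N. intros n Hn t Ht.
  assert (near : exists i, (i <= m)%nat /\ closed01 (INR i / INR m) /\ Rabs (t - INR i / INR m) <= / INR m).
  { destruct (nfloor_ex (t * INR m)) as [i [Hi1 Hi2]].
    { unfold closed01 in Ht. apply Rmult_le_pos; lra. }
    assert (Him : (i <= m)%nat).
    { apply INR_le. eapply Rle_trans; [exact Hi1|]. unfold closed01 in Ht. nra. }
    exists i. split; [exact Him|].
    assert (E : t = (t * INR m) / INR m) by (field; lra).
    assert (A1 : INR i / INR m <= t).
    { rewrite E. apply Rmult_le_compat_r; [left; apply Rinv_0_lt_compat, Hm|exact Hi1]. }
    assert (A2 : t <= INR i / INR m + / INR m).
    { rewrite E at 1. replace (INR i / INR m + / INR m) with ((INR i + 1) / INR m) by (field; lra).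
      apply Rmult_le_compat_r; [left; apply Rinv_0_lt_compat, Hm|lra]. }
    split; [split|].
    - apply Rdiv_le_0_compat; [apply pos_INR|exact Hm].
    - unfold closed01 in Ht; lra.
    - apply Rabs_le; lra. }
  destruct near as [i [Him [Hi Hti]]].
  set (x := INR i / INR m) in *.
  replace (v n t - u t) with ((v n t - v n x) + (v n x - u x) + (u x - u t)) by ring.
  assert (B1 : Rabs (v n t - v n x) < eps / 3).
  { eapply Rle_lt_trans; [apply Hv; assumption|]. eapply Rle_lt_trans; [|exact Hm3].
    apply Rmult_le_compat_l; assumption. }
  assert (B2 : Rabs (v n x - u x) < eps / 3) by (apply HN; assumption).
  assert (B3 : Rabs (u x - u t) < eps / 3).
  { eapply Rle_lt_trans; [apply Lu; assumption|]. eapply Rle_lt_trans; [|exact Hm3].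
    rewrite Rabs_minus_sym. apply Rmult_le_compat_l; assumption. }
  eapply Rle_lt_trans; [apply Rabs_triang|].
  eapply Rle_lt_trans; [apply Rplus_le_compat_r, Rabs_triang|]. lra.
Qed.

Lemma solves_ext (u g g' : R -> R) :
  (forall t, closed01 t -> g t = g' t) -> solves u g -> solves u g'.
Proof.
  intros E [Hc [H0 [H1 [u1 Hu]]]]. repeat split; auto.
  exists u1. intros t Ht. rewrite <- (E t Ht). apply Hu, Ht.
Qed.

(** Derivatives are never passed to the limit: the limit is identified with the Poisson solution [w]
    for [h], because [solves_bound] makes [v n - w] as small as [g n - h]. *)
Lemma solves_limit (v g : nat -> R -> R) (u h : R -> R) :
  (forall n, solves (v n) (g n)) ->
  (forall t, closed01 t -> is_lim_seq (fun n => v n t) (u t)) ->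
  (forall t, continuous h t) ->
  (forall eps, 0 < eps -> exists N, forall n, (N <= n)%nat ->
    forall t, closed01 t -> Rabs (g n t - h t) <= eps) ->
  exists w, solves w h /\ forall t, closed01 t -> w t = u t.
Proof.
  intros Hv Hu Hh Hg. destruct (poisson_solution h Hh) as [w Hw].
  exists w. split; [exact Hw|]. intros t Ht.
  assert (L : is_lim_seq (fun n => v n t) (w t)).
  { apply is_lim_seq_spec. intros eps.
    destruct (Hg (eps / 2)) as [N HN]; [apply is_pos_div_2|].
    exists N. intros n Hn.
    apply Rle_lt_trans with (eps / 2); [|pose proof (cond_pos eps); lra].
    apply (solves_bound (fun t => v n t - w t) (fun t => g n t - h t)); [|intros; apply HN|]; auto.
    apply solves_minus; auto. }
  apply is_lim_seq_unique in L. pose proof (is_lim_seq_unique _ _ (Hu t Ht)) as L'.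
  rewrite L in L'. congruence.
Qed.

(** The last clause quantifies over [h] after [u] is produced, because in the applications the
    limiting right-hand side depends on [u] itself. *)
Lemma monotone_limit (v g : nat -> R -> R) (a : R -> R) (P : R) :
  (forall n, solves (v n) (g n)) ->
  (forall n t, closed01 t -> Rabs (g n t) <= P) ->
  (forall n t, closed01 t -> v (S n) t <= v n t) ->
  (forall n t, closed01 t -> a t <= v n t) ->
  exists u, (forall t, continuous u t) /\
    (forall t, closed01 t -> a t <= u t) /\
    (forall n t, closed01 t -> u t <= v n t) /\
    (forall eps, 0 < eps -> exists N, forall n, (N <= n)%nat ->
      forall t, closed01 t -> Rabs (v n t - u t) < eps) /\
    (forall h, (forall t, continuous h t) ->
      (forall eps, 0 < eps -> exists N, forall n, (N <= n)%nat ->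
        forall t, closed01 t -> Rabs (g n t - h t) <= eps) ->
      exists w, solves w h /\ forall t, closed01 t -> w t = u t).
Proof.
  intros Hv HP Hdec Ha.
  set (l := fun t => real (Lim_seq (fun n => v n t))).
  assert (Hl : forall t, closed01 t -> is_lim_seq (fun n => v n t) (l t)).
  { intros t Ht. apply Lim_seq_correct'.
    apply (ex_finite_lim_seq_decr _ (a t)); intros n; auto. }
  assert (Hunif := equi_lip_uniform v l P (fun n => solves_lip _ _ _ (Hv n) (HP n)) Hl).
  (* Outside [[0,1]] convergence is unknown and [l] may be a default value; clamping makes the limit
     continuous on the line. *)
  exists (fun t => l (clamp 0 1 t)).
  assert (E : forall t, closed01 t -> l (clamp 0 1 t) = l t).
  { intros t Ht. rewrite clamp_id; auto. }
  split; [|split; [|split; [|split]]].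
  - apply continuous_clamp; [lra|]. intros x Hx eps He.
    destruct (Hunif (eps / 3)) as [N HN]; [lra|].
    destruct (Hv N) as [Hc _]. destruct (proj1 (continuous_eps _ x) (Hc x) (eps / 3)) as [d [Hd K]]; [lra|].
    exists d; split; [exact Hd|]. intros y Hy Hyx. specialize (K y Hyx).
    assert (K1 := HN N (le_n N) x Hx). assert (K2 := HN N (le_n N) y Hy).
    apply Rabs_def2 in K. apply Rabs_def2 in K1. apply Rabs_def2 in K2.
    apply Rabs_def1; lra.
  - intros t Ht. rewrite E by exact Ht.
    apply (is_lim_seq_le (fun _ => a t) (fun n => v n t) (a t) (l t)); auto.
    apply is_lim_seq_const.
  - intros n t Ht. rewrite E by exact Ht.
    apply (is_lim_seq_decr_compare (fun n => v n t)); auto.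
  - intros eps He. destruct (Hunif eps He) as [N HN]. exists N. intros n Hn t Ht.
    rewrite E by exact Ht. auto.
  - intros h Hh Hg. destruct (solves_limit v g l h Hv Hl Hh Hg) as [w [Hw Ew]].
    exists w. split; [exact Hw|]. intros t Ht. rewrite E by exact Ht. auto.
Qed.

Definition subsolution (G : R -> R -> R) (a : R -> R) : Prop :=
  (forall t, continuous a t) /\ a 0 <= 0 /\ a 1 <= 0 /\
  exists a1 a2, forall t, open01 t ->
    is_derive a t (a1 t) /\ is_derive a1 t (a2 t) /\ - a2 t <= G t (a t).

(** Derivatives are asked for in the open interval only, since the barrier used later has infinite
    slope at 0 and 1. *)
Definition supersolution (G : R -> R -> R) (b : R -> R) : Prop :=
  (forall t, continuous b t) /\ 0 <= b 0 /\ 0 <= b 1 /\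
  exists b1 b2, forall t, open01 t ->
    is_derive b t (b1 t) /\ is_derive b1 t (b2 t) /\ G t (b t) <= - b2 t.

Definition ucont2 (G : R -> R -> R) : Prop :=
  forall eps, 0 < eps -> exists d, 0 < d /\ forall t s u v,
    Rabs (t - s) < d -> Rabs (u - v) < d -> Rabs (G t u - G s v) < eps.

Lemma ucont2_comp (G : R -> R -> R) (v : R -> R) :
  ucont2 G -> (forall t, continuous v t) -> forall t, continuous (fun t => G t (v t)) t.
Proof.
  intros HG Hv t. apply continuous_eps. intros eps He.
  destruct (HG eps He) as [d [Hd K]].
  destruct (proj1 (continuous_eps v t) (Hv t) d Hd) as [d' [Hd' K']].
  exists (Rmin d d'). split; [apply Rmin_glb_lt; assumption|].
  intros y Hy. apply K.
  - eapply Rlt_le_trans; [exact Hy|apply Rmin_l].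
  - apply K'. eapply Rlt_le_trans; [exact Hy|apply Rmin_r].
Qed.

Lemma open_closed t : open01 t -> closed01 t.
Proof. unfold open01, closed01; lra. Qed.

(** With [k] a Lipschitz constant, [G t u + k u] is nondecreasing in [u], and [-w'' + k w] obeys the
    maximum principle. The new [w] solves [-w'' + k w = G t v + k v]; from [w <= v] it is again a
    supersolution. *)
Lemma monotone_step (G : R -> R -> R) (k : R) (a v : R -> R) :
  0 < k -> ucont2 G ->
  (forall t u w, Rabs (G t u - G t w) <= k * Rabs (u - w)) ->
  subsolution G a -> supersolution G v ->
  (forall t, closed01 t -> a t <= v t) ->
  exists w, solves w (fun t => G t (v t) + k * (v t - w t)) /\
    supersolution G w /\
    (forall t, closed01 t -> a t <= w t) /\
    (forall t, closed01 t -> w t <= v t).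
Proof.
  intros Hk HG Hlip [Ca [A0 [A1 [a1 [a2 Ha]]]]] [Cv [V0 [V1 [v1 [v2 Hv]]]]] Hav.
  destruct (helmholtz_solution k (fun t => G t (v t) + k * v t) Hk) as [w Hw].
  { intros t. apply (continuous_plus (fun t => G t (v t)) (fun t => k * v t)).
    - apply ucont2_comp; assumption.
    - apply (continuous_scal_r k v), Cv. }
  exists w.
  assert (mono : forall t x y, x <= y -> G t x + k * x <= G t y + k * y).
  { intros t x y Hxy. specialize (Hlip t x y).
    rewrite (Rabs_minus_sym x y), (Rabs_pos_eq (y - x)) in Hlip by lra.
    apply Rabs_le_between in Hlip. lra. }
  destruct Hw as [Cw [W0 [W1 [w1 Hw]]]].
  assert (Hwv : forall t, closed01 t -> w t <= v t).
  { intros t Ht. apply Rminus_le.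
    apply (max_principle (fun t => w t - v t) (fun t => w1 t - v1 t)
      (fun t => - (G t (v t) + k * v t - k * w t) - v2 t)); try lra; try exact Ht.
    - intros s. apply (continuous_minus w v); auto.
    - intros s Hs. destruct (Hw s (open_closed s Hs)) as [E1 E2].
      destruct (Hv s Hs) as [F1 [F2 _]]. split.
      + apply (is_derive_minus w v); assumption.
      + apply (is_derive_minus w1 v1); assumption.
    - intros s Hs Hpos. destruct (Hv s Hs) as [_ [_ F]]. nra. }
  assert (Haw : forall t, closed01 t -> a t <= w t).
  { intros t Ht. apply Rminus_le.
    apply (max_principle (fun t => a t - w t) (fun t => a1 t - w1 t)
      (fun t => a2 t - - (G t (v t) + k * v t - k * w t))); try lra; try exact Ht.
    - intros s. apply (continuous_minus a w); auto.
    - intros s Hs. destruct (Hw s (open_closed s Hs)) as [E1 E2].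
      destruct (Ha s Hs) as [F1 [F2 _]]. split.
      + apply (is_derive_minus a w); assumption.
      + apply (is_derive_minus a1 w1); assumption.
    - intros s Hs Hpos. destruct (Ha s Hs) as [_ [_ F]].
      specialize (mono s (a s) (v s) (Hav s (open_closed s Hs))). nra. }
  split; [|split; [|split]]; try assumption.
  - split; [exact Cw|split; [exact W0|split; [exact W1|]]].
    exists w1. intros t Ht. destruct (Hw t Ht) as [E1 E2]. split; [exact E1|].
    replace (- (G t (v t) + k * (v t - w t))) with (- (G t (v t) + k * v t - k * w t)) by ring.
    exact E2.
  - split; [exact Cw|split; [lra|split; [lra|]]].
    exists w1, (fun t => - (G t (v t) + k * v t - k * w t)).
    intros t Ht. destruct (Hw t (open_closed t Ht)) as [E1 E2].
    split; [exact E1|split; [exact E2|]].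
    specialize (mono t (w t) (v t) (Hwv t (open_closed t Ht))). lra.
Qed.

Lemma continuous_bounded (f : R -> R) : (forall t, continuous f t) ->
  exists C, 0 <= C /\ forall t, closed01 t -> Rabs (f t) <= C.
Proof.
  intros Hf.
  destruct (continuity_ab_maj (fun t => Rabs (f t)) 0 1) as [x [Hx _]]; [lra| |].
  - intros c _. apply (continuous_pt (fun t => Rabs (f t))).
    apply (continuous_comp f Rabs); [apply Hf|apply continuous_Rabs].
  - exists (Rabs (f x)). split; [apply Rabs_pos|]. intros t Ht. apply Hx, Ht.
Qed.

Lemma lipschitz_sub_super (G : R -> R -> R) (M k : R) (a b : R -> R) :
  0 < k -> ucont2 G -> (forall t u, Rabs (G t u) <= M) ->
  (forall t u w, Rabs (G t u - G t w) <= k * Rabs (u - w)) ->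
  subsolution G a -> supersolution G b -> (forall t, closed01 t -> a t <= b t) ->
  exists u, solves u (fun t => G t (u t)) /\
    (forall t, closed01 t -> a t <= u t) /\ (forall t, closed01 t -> u t <= b t).
Proof.
  intros Hk HG HM Hlip Ha Hb Hab.
  destruct (dependent_choice (R -> R)
    (fun n v => supersolution G v /\ forall t, closed01 t -> a t <= v t)
    (fun n v w => solves w (fun t => G t (v t) + k * (v t - w t)) /\
       forall t, closed01 t -> w t <= v t) b) as [s [Hs0 Hs]].
  - split; assumption.
  - intros n v [Hv Hav].
    destruct (monotone_step G k a v Hk HG Hlip Ha Hv Hav) as [w [W1 [W2 [W3 W4]]]].
    exists w. exact (conj (conj W2 W3) (conj W1 W4)).
  - assert (Hsb : forall n t, closed01 t -> s n t <= b t).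
    { induction n as [|n IH]; intros t Ht; [rewrite Hs0; lra|].
      eapply Rle_trans; [apply (proj2 (Hs n)), Ht|auto]. }
    destruct (continuous_bounded a (proj1 Ha)) as [Ma [Ma0 HMa]].
    destruct (continuous_bounded b (proj1 Hb)) as [Mb [Mb0 HMb]].
    (* The residual [k (s n - s (S n))] is part of the right-hand side, so its size enters the
       common Lipschitz constant. *)
    assert (osc : forall n t, closed01 t -> Rabs (s n t - s (S n) t) <= Ma + Mb).
    { intros n t Ht. pose proof (proj2 (proj1 (Hs n)) t Ht).
      pose proof (proj2 (proj1 (Hs (S n))) t Ht).
      pose proof (Hsb n t Ht). pose proof (Hsb (S n) t Ht).
      specialize (HMa t Ht). specialize (HMb t Ht).
      apply Rabs_le_between in HMa. apply Rabs_le_between in HMb. apply Rabs_le. lra. }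
    (* The sequence is shifted because [s 0 = b] is only a supersolution. *)
    destruct (monotone_limit (fun n => s (S n))
      (fun n t => G t (s n t) + k * (s n t - s (S n) t)) a (M + k * (Ma + Mb)))
      as [u [Cu [Hau [Hus [Hunif Hlim]]]]].
    + intros n. apply (proj2 (Hs n)).
    + intros n t Ht. eapply Rle_trans; [apply Rabs_triang|].
      apply Rplus_le_compat; [apply HM|].
      rewrite Rabs_mult, (Rabs_pos_eq k) by lra. apply Rmult_le_compat_l; [lra|auto].
    + intros n t Ht. apply (proj2 (Hs (S n))), Ht.
    + intros n t Ht. apply (proj2 (proj1 (Hs (S n)))), Ht.
    + destruct (Hlim (fun t => G t (u t))) as [w [Hw Ew]].
      * apply ucont2_comp; assumption.
      (* The change of [G] costs [eps/4] and the residual [eps/2]. The right-hand side of index [n]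
         contains [s n], which is term [n - 1] of the shifted sequence, hence the witness [S N]. *)
      * intros eps He. destruct (Hunif (eps / (4 * k))) as [N HN].
        { apply Rdiv_lt_0_compat; lra. }
        exists (S N). intros n Hn t Ht.
        destruct n as [|n]; [lia|].
        assert (K1 := HN n ltac:(lia) t Ht). assert (K2 := HN (S n) ltac:(lia) t Ht).
        assert (K3 := Hlip t (s (S n) t) (u t)).
        set (x := s (S n) t) in *. set (y := s (S (S n)) t) in *.
        replace (G t x + k * (x - y) - G t (u t))
          with ((G t x - G t (u t)) + k * ((x - u t) - (y - u t))) by ring.
        eapply Rle_trans; [apply Rabs_triang|].
        rewrite (Rabs_mult k), (Rabs_pos_eq k) by lra.
        assert (K4 : Rabs (x - u t - (y - u t)) <= eps / (4 * k) + eps / (4 * k)).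
        { eapply Rle_trans; [apply Rabs_triang|]. rewrite Rabs_Ropp. lra. }
        assert (K5 : k * (eps / (4 * k)) = eps / 4) by (field; lra).
        nra.
      * exists w. split; [|split].
        -- apply solves_ext with (2 := Hw). intros t Ht. rewrite Ew; auto.
        -- intros t Ht. rewrite Ew; auto.
        -- intros t Ht. rewrite Ew by exact Ht.
           eapply Rle_trans; [apply (Hus 0%nat), Ht|apply Hsb, Ht].
Qed.

(** * From Lipschitz to merely continuous nonlinearities *)

Lemma bounded_sup (A : Type) (f : A -> R) (a0 : A) (M : R) :
  (forall a, f a <= M) ->
  exists l, (forall a, f a <= l) /\ forall c, (forall a, f a <= c) -> l <= c.
Proof.
  intros HM. destruct (completeness (fun z => exists a, z = f a)) as [l [Hl1 Hl2]].
  - exists M. intros z [a ->]. apply HM.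
  - exists (f a0), a0. reflexivity.
  - exists l. split.
    + intros a. apply Hl1. exists a; reflexivity.
    + intros c Hc. apply Hl2. intros z [a ->]. apply Hc.
Qed.

(* Sup-convolutions [sup_v (F t v - n |u - v|)]. *)
Lemma lipschitz_approximation (F : R -> R -> R) (M : R) :
  ucont2 F -> (forall t u, Rabs (F t u) <= M) ->
  exists G : nat -> R -> R -> R, forall n,
    ucont2 (G n) /\ (forall t u, Rabs (G n t u) <= M) /\
    (forall t u w, Rabs (G n t u - G n t w) <= INR n * Rabs (u - w)) /\
    (forall t u, F t u <= G n t u) /\ (forall t u, G (S n) t u <= G n t u) /\
    (forall eps, 0 < eps -> exists N, forall m, (N <= m)%nat ->
       forall t u, G m t u <= F t u + eps).
Proof.
  intros HF HM.
  assert (HMl : forall t u, - M <= F t u <= M) by (intros; apply Rabs_le_between, HM).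
  assert (HX : forall n t u, exists l, (forall v, F t v - INR n * Rabs (u - v) <= l) /\
    forall c, (forall v, F t v - INR n * Rabs (u - v) <= c) -> l <= c).
  { intros n t u. apply (bounded_sup R (fun v => F t v - INR n * Rabs (u - v)) 0 M).
    intros v. pose proof (pos_INR n). pose proof (Rabs_pos (u - v)). specialize (HMl t v). nra. }
  set (G := fun n t u => proj1_sig (constructive_indefinite_description _ (HX n t u))).
  assert (Gub : forall n t u v, F t v - INR n * Rabs (u - v) <= G n t u).
  { intros n t u. exact (proj1 (proj2_sig (constructive_indefinite_description _ (HX n t u)))). }
  assert (Glub : forall n t u c, (forall v, F t v - INR n * Rabs (u - v) <= c) -> G n t u <= c).
  { intros n t u. exact (proj2 (proj2_sig (constructive_indefinite_description _ (HX n t u)))). }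
  clearbody G.
  assert (FG : forall n t u, F t u <= G n t u).
  { intros n t u. specialize (Gub n t u u). rewrite Rminus_diag, Rabs_R0 in Gub. lra. }
  assert (lip : forall n t u w, Rabs (G n t u - G n t w) <= INR n * Rabs (u - w)).
  { assert (one : forall n t u w, G n t u <= G n t w + INR n * Rabs (u - w)).
    { intros n t u w. apply Glub. intros v. specialize (Gub n t w v).
      pose proof (Rabs_triang (w - u) (u - v)).
      replace (w - u + (u - v)) with (w - v) in H by ring.
      rewrite (Rabs_minus_sym w u) in H. pose proof (pos_INR n). nra. }
    intros n t u w. pose proof (one n t u w). pose proof (one n t w u).
    rewrite (Rabs_minus_sym w u) in H0. apply Rabs_le; lra. }
  exists G. intros n. split; [|split; [|split; [|split; [|split]]]].
  - intros eps He. destruct (HF (eps / 2)) as [d [Hd K]]; [lra|].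
    assert (tcont : forall t s u, Rabs (t - s) < d -> G n t u <= G n s u + eps / 2).
    { intros t s u Hts. apply Glub. intros v. specialize (Gub n s u v).
      specialize (K t s v v Hts). rewrite Rminus_diag, Rabs_R0 in K. specialize (K Hd).
      apply Rabs_def2 in K. lra. }
    pose proof (pos_INR n) as Hn.
    exists (Rmin d (eps / (4 * (INR n + 1)))). split.
    { apply Rmin_glb_lt; [exact Hd|]. apply Rdiv_lt_0_compat; lra. }
    intros t s u v Hts Huv.
    assert (Hts' : Rabs (t - s) < d) by (eapply Rlt_le_trans; [exact Hts|apply Rmin_l]).
    assert (Huv' : Rabs (u - v) < eps / (4 * (INR n + 1))) by (eapply Rlt_le_trans; [exact Huv|apply Rmin_r]).
    pose proof (tcont t s u Hts') as E1. rewrite Rabs_minus_sym in Hts'.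
    pose proof (tcont s t u Hts') as E2.
    assert (E3 := lip n s u v).
    assert (E4 : INR n * Rabs (u - v) <= eps / 4).
    { pose proof (Rabs_pos (u - v)).
      apply Rle_trans with ((INR n + 1) * (eps / (4 * (INR n + 1)))); [nra|].
      right; field; lra. }
    apply Rabs_le_between in E3. apply Rabs_def1; lra.
  - intros t u. apply Rabs_le. split.
    + eapply Rle_trans; [apply HMl|apply FG].
    + apply Glub. intros v. pose proof (pos_INR n). pose proof (Rabs_pos (u - v)).
      specialize (HMl t v). nra.
  - apply lip.
  - apply FG.
  - intros t u. apply Glub. intros v. specialize (Gub n t u v).
    rewrite S_INR. pose proof (Rabs_pos (u - v)). nra.
  (* For [|u - v| < d] uniform continuity gives the bound; for [|u - v| >= d] the penalty
     [m |u - v|] is at least [2 M], which exceeds any gain in [F]. *)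
  - intros eps He. destruct (HF eps He) as [d [Hd K]].
    destruct (nfloor_ex (Rmax 0 (2 * M / d)) (Rmax_l _ _)) as [N [_ HN]].
    exists (S N). intros m Hm t u. apply Glub. intros v.
    apply le_INR in Hm. rewrite S_INR in Hm.
    pose proof (Rmax_r 0 (2 * M / d)).
    assert (Hmd : 2 * M <= INR m * d).
    { apply Rle_div_l; [exact Hd|]. lra. }
    pose proof (pos_INR m). pose proof (Rabs_pos (u - v)).
    destruct (Rlt_or_le (Rabs (u - v)) d) as [Hlt|Hge].
    + rewrite Rabs_minus_sym in Hlt. specialize (K t t v u).
      rewrite Rminus_diag, Rabs_R0 in K. specialize (K Hd Hlt). apply Rabs_def2 in K. nra.
    + pose proof (HMl t v). pose proof (HMl t u). nra.
Qed.

(** The summand 1 leaves room for the approximations from above: [b] is a supersolution for each of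
    them that lies below [F + 1]. *)
Lemma sub_super_solution (F : R -> R -> R) (M : R) (a b : R -> R) :
  ucont2 F -> (forall t u, Rabs (F t u) <= M) ->
  subsolution F a -> supersolution (fun t u => F t u + 1) b ->
  (forall t, closed01 t -> a t <= b t) ->
  exists u, solves u (fun t => F t (u t)) /\
    (forall t, closed01 t -> a t <= u t) /\ (forall t, closed01 t -> u t <= b t).
Proof.
  intros HF HM Ha Hb Hab.
  destruct (lipschitz_approximation F M HF HM) as [G HG].
  destruct (HG 0%nat) as [_ [_ [_ [_ [_ Happ]]]]].
  destruct (Happ 1 Rlt_0_1) as [N HN].
  (* Beyond [N] the approximations are at most [F + 1]; the successor makes the Lipschitz constant
     positive. *)
  set (H := fun n => G (S (N + n))).
  assert (HaH : forall n, subsolution (H n) a).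
  { intros n. destruct Ha as [Ca [A0 [A1 [a1 [a2 Ha]]]]].
    repeat split; try assumption. exists a1, a2. intros t Ht.
    destruct (Ha t Ht) as [E1 [E2 E3]]. split; [exact E1|split; [exact E2|]].
    eapply Rle_trans; [exact E3|]. exact (proj1 (proj2 (proj2 (proj2 (HG (S (N + n)))))) t (a t)). }
  destruct (dependent_choice (R -> R)
    (fun n v => supersolution (H n) v /\ forall t, closed01 t -> a t <= v t)
    (fun n v w => solves w (fun t => H n t (w t)) /\
       forall t, closed01 t -> w t <= v t) b) as [s [Hs0 Hs]].
  - split; [|exact Hab]. destruct Hb as [Cb [B0 [B1 [b1 [b2 Hb]]]]].
    repeat split; try assumption. exists b1, b2. intros t Ht.
    destruct (Hb t Ht) as [E1 [E2 E3]]. split; [exact E1|split; [exact E2|]].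
    eapply Rle_trans; [|exact E3]. apply HN. lia.
  - intros n v [Hv Hav].
    destruct (HG (S (N + n))) as [G1 [G2 [G3 [G4 [G5 _]]]]].
    destruct (lipschitz_sub_super (H n) M (INR (S (N + n))) a v) as [w [W1 [W2 W3]]]; auto.
    { apply lt_0_INR; lia. }
    exists w. split; [split|split]; try assumption.
    destruct W1 as [Cw [W0 [W1' [w1 Hw]]]].
    split; [exact Cw|split; [lra|split; [lra|]]].
    exists w1, (fun t => - H n t (w t)). intros t Ht.
    destruct (Hw t (open_closed t Ht)) as [E1 E2]. split; [exact E1|split; [exact E2|]].
    rewrite Ropp_involutive. unfold H. rewrite Nat.add_succ_r. apply G5.
  - destruct (monotone_limit (fun n => s (S n)) (fun n t => H n t (s (S n) t)) a M)
      as [u [Cu [Hau [Hus [Hunif Hlim]]]]].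
    + intros n. apply (proj2 (Hs n)).
    + intros n t Ht. apply HG.
    + intros n t Ht. apply (proj2 (Hs (S n))), Ht.
    + intros n t Ht. apply (proj2 (proj1 (Hs (S n)))), Ht.
    + destruct (Hlim (fun t => F t (u t))) as [w [Hw Ew]].
      * apply ucont2_comp; assumption.
      * intros eps He. destruct (HF (eps / 2)) as [d [Hd K]]; [lra|].
        destruct (Hunif d Hd) as [N1 HN1].
        destruct (Happ (eps / 2)) as [N2 HN2]; [lra|].
        exists (N1 + N2)%nat. intros n Hn t Ht.
        assert (K1 := HN2 (S (N + n)) ltac:(lia) t (s (S n) t)).
        destruct (HG (S (N + n))) as [_ [_ [_ [G4 _]]]].
        specialize (G4 t (s (S n) t)).
        specialize (K t t (s (S n) t) (u t)). rewrite Rminus_diag, Rabs_R0 in K.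
        specialize (K Hd (HN1 n ltac:(lia) t Ht)). apply Rabs_def2 in K.
        fold (H n) in *. apply Rabs_le; lra.
      * exists w. split; [|split].
        -- apply solves_ext with (2 := Hw). intros t Ht. rewrite Ew; auto.
        -- intros t Ht. rewrite Ew; auto.
        -- intros t Ht. rewrite Ew by exact Ht.
           eapply Rle_trans; [apply (Hus 0%nat), Ht|]. rewrite <- Hs0.
           apply (proj2 (Hs 0%nat)), Ht.
Qed.

(** * The linear initial value problem *)

(** Both [q - p] and [q + p] are nondecreasing. *)
Lemma derivative_comparison (p p1 q q1 : R -> R) :
  (forall t, closed01 t -> is_derive p t (p1 t)) ->
  (forall t, closed01 t -> is_derive q t (q1 t)) ->
  (forall t, closed01 t -> Rabs (p1 t) <= q1 t) -> Rabs (p 0) <= q 0 ->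
  forall t, closed01 t -> Rabs (p t) <= q t.
Proof.
  intros Hp Hq H H0 t [Ht1 Ht2].
  destruct (Req_dec t 0) as [->|Hne]; [exact H0|].
  apply Rabs_le_between in H0.
  destruct (MVT_cor2 (fun s => q s - p s) (fun s => q1 s - p1 s) 0 t) as [c [Hc1 Hc2]]; [lra| |].
  { intros c Hc. apply is_derive_Reals, (is_derive_minus q p); [apply Hq|apply Hp]; unfold closed01; lra. }
  destruct (MVT_cor2 (fun s => q s + p s) (fun s => q1 s + p1 s) 0 t) as [d [Hd1 Hd2]]; [lra| |].
  { intros d Hd. apply is_derive_Reals, (is_derive_plus q p); [apply Hq|apply Hp]; unfold closed01; lra. }
  pose proof (H c ltac:(unfold closed01; lra)) as Kc.
  pose proof (H d ltac:(unfold closed01; lra)) as Kd.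
  apply Rabs_le_between in Kc. apply Rabs_le_between in Kd.
  apply Rabs_le. nra.
Qed.

(** Twofold primitive vanishing to first order at 0. It turns the initial value problem into the
    Volterra equation [y = t - l dint (m y)]. *)
Definition dint (h : R -> R) (t : R) : R := RInt (fun s => RInt h 0 s) 0 t.

Lemma dint_derive (h : R -> R) : (forall t, continuous h t) -> forall t : R,
  is_derive (dint h) t (RInt h 0 t) /\ is_derive (fun s : R => RInt h 0 s) t (h t).
Proof.
  intros Hh t. split; [|apply is_derive_primitive, Hh].
  apply (is_derive_primitive (fun s => RInt h 0 s)). intros s.
  eapply is_derive_continuous, is_derive_primitive, Hh.
Qed.

Lemma RInt_at_point (h : R -> R) (a : R) : RInt h a a = 0.
Proof. exact (RInt_point (V := R_CompleteNormedModule) a h). Qed.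

Lemma dint_0 h : dint h 0 = 0.
Proof. apply RInt_at_point. Qed.

Lemma continuous_dint (h : R -> R) : (forall t, continuous h t) -> forall t, continuous (dint h) t.
Proof. intros Hh t. exact (is_derive_continuous _ _ _ (proj1 (dint_derive h Hh t))). Qed.

(* The weight [exp (w t)] with [w] large turns [dint] into a contraction. *)
Lemma dint_bound (h : R -> R) (C w : R) : 0 < w -> 0 <= C ->
  (forall t, continuous h t) -> (forall t, closed01 t -> Rabs (h t) <= C * exp (w * t)) ->
  forall t, closed01 t -> Rabs (dint h t) <= t * (C / w * exp (w * t)).
Proof.
  intros Hw HC Hh Hb.
  assert (Hexp : forall t, 0 < exp (w * t)) by (intros; apply exp_pos).
  assert (HCw : 0 <= C / w) by (apply Rdiv_le_0_compat; lra).
  assert (I : forall t, closed01 t -> Rabs (RInt h 0 t) <= C / w * exp (w * t)).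
  { apply (derivative_comparison _ h _ (fun t => C * exp (w * t))); auto.
    - intros t _. exact (proj2 (dint_derive h Hh t)).
    - intros t _. auto_derive; [exact I|field; lra].
    - rewrite RInt_at_point, Rabs_R0. pose proof (Hexp 0). nra. }
  apply (derivative_comparison _ (fun t => RInt h 0 t) _
    (fun t => C / w * exp (w * t) + t * (C / w * (w * exp (w * t))))).
  - intros t _. exact (proj1 (dint_derive h Hh t)).
  - intros t _. auto_derive; [exact Logic.I|ring].
  - intros t Ht. specialize (I t Ht). destruct Ht as [Ht1 Ht2].
    assert (0 <= t * (C / w * (w * exp (w * t)))); [|lra].
    pose proof (Hexp t). apply Rmult_le_pos; [exact Ht1|]. apply Rmult_le_pos; [exact HCw|nra].
  - rewrite dint_0, Rabs_R0, Rmult_0_l. lra.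
Qed.

(** The identity between integrands is assumed on [[0,1]] only, so functions that differ outside can
    be exchanged. Proof: two comparisons of the difference with the zero function. *)
Lemma dint_linear (f g h : R -> R) (a b : R) :
  (forall t, continuous f t) -> (forall t, continuous g t) -> (forall t, continuous h t) ->
  (forall t, closed01 t -> h t = a * f t + b * g t) ->
  forall t, closed01 t -> dint h t = a * dint f t + b * dint g t.
Proof.
  intros Hf Hg Hh E t Ht.
  assert (Dh := dint_derive h Hh). assert (Df := dint_derive f Hf). assert (Dg := dint_derive g Hg).
  assert (lin : forall (p q r p1 q1 r1 : R -> R) (x : R), is_derive p x (p1 x) -> is_derive q x (q1 x) ->
    is_derive r x (r1 x) ->
    is_derive (fun s => p s - (a * q s + b * r s)) x (p1 x - (a * q1 x + b * r1 x))).
  { intros p q r p1 q1 r1 x Hp Hq Hr.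
    apply (is_derive_minus p (fun s => a * q s + b * r s)); [exact Hp|].
    apply (is_derive_plus (fun s => a * q s) (fun s => b * r s)).
    - apply (is_derive_scal q x a); exact Hq.
    - apply (is_derive_scal r x b); exact Hr. }
  assert (Z : forall x, Rabs x <= 0 -> x = 0).
  { intros x Hx. apply Rabs_le_between in Hx. lra. }
  apply Rminus_diag_uniq, Z.
  apply (derivative_comparison (fun t => dint h t - (a * dint f t + b * dint g t))
    (fun t => RInt h 0 t - (a * RInt f 0 t + b * RInt g 0 t)) (fun _ => 0) (fun _ => 0)); try exact Ht.
  - intros s _. apply (lin _ _ _ (fun t => RInt h 0 t) (fun t => RInt f 0 t) (fun t => RInt g 0 t));
      [exact (proj1 (Dh s))|exact (proj1 (Df s))|exact (proj1 (Dg s))].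
  - intros s _. apply (is_derive_const 0 s).
  - apply (derivative_comparison _ (fun t => h t - (a * f t + b * g t)) _ (fun _ => 0)).
    + intros s _. apply (lin _ _ _ h f g); [exact (proj2 (Dh s))|exact (proj2 (Df s))|exact (proj2 (Dg s))].
    + intros s _. apply (is_derive_const 0 s).
    + intros s Hs. rewrite (E s Hs), Rminus_diag, Rabs_R0. lra.
    + rewrite !RInt_at_point. replace (0 - (a * 0 + b * 0)) with 0 by ring. rewrite Rabs_R0; lra.
  - rewrite !dint_0. replace (0 - (a * 0 + b * 0)) with 0 by ring. rewrite Rabs_R0; lra.
Qed.

Section Linear.

Variables (m : R -> R) (M : R).
Hypothesis Hm : forall t, continuous m t.
Hypothesis HM : forall t, 0 <= m t <= M.

Let cm (f : R -> R) (Hf : forall t, continuous f t) : forall t, continuous (fun s => m s * f s) t.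
Proof. intros t. apply (continuous_mult m f); auto. Qed.

Let M_pos : 0 <= M.
Proof. specialize (HM 0); lra. Qed.

Lemma dint_weight_bound (f : R -> R) (C w : R) : 0 < w -> 0 <= C ->
  (forall t, continuous f t) -> (forall t, closed01 t -> Rabs (f t) <= C * exp (w * t)) ->
  forall t, closed01 t -> Rabs (dint (fun s => m s * f s) t) <= t * (C * M / w * exp (w * t)).
Proof.
  intros Hw HC Hf Hb. apply dint_bound; try assumption.
  - apply Rmult_le_pos; assumption.
  - apply cm, Hf.
  - intros t Ht. rewrite Rabs_mult, (Rabs_pos_eq (m t)) by apply HM.
    specialize (Hb t Ht). pose proof (Rabs_pos (f t)). specialize (HM t).
    replace (C * M * exp (w * t)) with (M * (C * exp (w * t))) by ring.
    apply Rmult_le_compat; lra.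
Qed.

(** In the norm [sup |f| exp (- w t)] the integral operator has factor [|l| M / w <= 1/2], for any
    size of [l]. The extra factor [t] is kept for estimates near 0. *)
Lemma dint_contraction (f : R -> R) (C w l : R) : 0 < w -> Rabs l * M <= w / 2 -> 0 <= C ->
  (forall t, continuous f t) -> (forall t, closed01 t -> Rabs (f t) <= C * exp (w * t)) ->
  forall t, closed01 t -> Rabs (l * dint (fun s => m s * f s) t) <= t * (C / 2 * exp (w * t)).
Proof.
  intros Hw Hl HC Hf Hb t Ht. rewrite Rabs_mult.
  assert (H := dint_weight_bound f C w Hw HC Hf Hb t Ht).
  apply Rle_trans with (Rabs l * (t * (C * M / w * exp (w * t)))).
  { apply Rmult_le_compat_l; [apply Rabs_pos|exact H]. }
  replace (Rabs l * (t * (C * M / w * exp (w * t)))) with ((Rabs l * M) * (t * C * exp (w * t) / w)) by (field; lra).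
  replace (t * (C / 2 * exp (w * t))) with (w / 2 * (t * C * exp (w * t) / w)) by (field; lra).
  apply Rmult_le_compat_r; [|exact Hl].
  apply Rdiv_le_0_compat; [|exact Hw]. pose proof (exp_pos (w * t)). destruct Ht.
  apply Rmult_le_pos; [apply Rmult_le_pos|]; lra.
Qed.

(** A Gronwall bound: the weighted norm [B] of [D] is attained at some [x], where the contraction
    gives [B <= C + B / 2]. With [C = 0] it is a uniqueness statement. *)
Lemma volterra_bound (D p : R -> R) (l w C : R) : 0 < w -> Rabs l * M <= w / 2 ->
  (forall t, continuous D t) ->
  (forall t, closed01 t -> D t = p t - l * dint (fun s => m s * D s) t) ->
  (forall t, closed01 t -> Rabs (p t) <= C) ->
  forall t, closed01 t -> Rabs (D t) <= 2 * C * exp (w * t).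
Proof.
  intros Hw Hl HD E Hp t Ht.
  destruct (continuity_ab_maj (fun t => Rabs (D t) * exp (- (w * t))) 0 1) as [x [Hx Hx01]]; [lra| |].
  { intros c _. apply (continuous_pt (fun t => Rabs (D t) * exp (- (w * t)))).
    apply (continuous_mult (fun t => Rabs (D t)) (fun t => exp (- (w * t)))).
    - apply (continuous_comp D Rabs); [apply HD|apply continuous_Rabs].
    - apply (is_derive_continuous _ _ (- w * exp (- (w * c)))). auto_derive; [exact I|ring]. }
  assert (cancel : forall s, exp (- (w * s)) * exp (w * s) = 1).
  { intros s. rewrite <- exp_plus, Rplus_opp_l. apply exp_0. }
  set (B := Rabs (D x) * exp (- (w * x))) in *.
  assert (HB0 : 0 <= B) by (apply Rmult_le_pos; [apply Rabs_pos|left; apply exp_pos]).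
  assert (HB : forall s, closed01 s -> Rabs (D s) <= B * exp (w * s)).
  { intros s Hs. specialize (Hx s Hs). pose proof (exp_pos (w * s)).
    apply Rmult_le_compat_r with (r := exp (w * s)) in Hx; [|lra].
    rewrite Rmult_assoc, cancel in Hx. lra. }
  assert (K := dint_contraction D B w l Hw Hl HB0 HD HB x Hx01).
  assert (EB : Rabs (D x) = B * exp (w * x)).
  { unfold B. rewrite Rmult_assoc, cancel. ring. }
  assert (HBC : B <= 2 * C).
  { rewrite (E x Hx01) in EB.
    assert (T := Rabs_triang (p x) (- (l * dint (fun s => m s * D s) x))).
    rewrite Rabs_Ropp in T. specialize (Hp x Hx01).
    assert (1 <= exp (w * x)).
    { destruct Hx01. replace 1 with (exp 0) by apply exp_0.
      destruct (Req_dec x 0) as [->|]; [rewrite Rmult_0_r; lra|].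
      left. apply exp_increasing. nra. }
    unfold Rminus in EB.
    assert (x * (B / 2 * exp (w * x)) <= B / 2 * exp (w * x)).
    { rewrite <- (Rmult_1_l (B / 2 * exp (w * x))) at 2. apply Rmult_le_compat_r; [|lra].
      apply Rmult_le_pos; lra. }
    nra. }
  eapply Rle_trans; [apply HB, Ht|]. apply Rmult_le_compat_r; [left; apply exp_pos|exact HBC].
Qed.

(** Both forms are recorded: the integral equation serves the estimates, the derivatives serve
    concavity and the eigenvalue equation. *)
Definition ivp_solution (l : R) (y : R -> R) : Prop :=
  (forall t, continuous y t) /\
  (forall t, closed01 t -> y t = t - l * dint (fun s => m s * y s) t) /\
  exists y1, y1 0 = 1 /\
    forall t, closed01 t -> is_derive y t (y1 t) /\ is_derive y1 t (- (l * (m t * y t))).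

(** Picard iteration in the weighted norm, where [K] contracts by 1/2 on all of [[0,1]]. *)
Lemma ivp_exists (l : R) : exists y, ivp_solution l y.
Proof.
  set (K := fun (f : R -> R) (t : R) => t - l * dint (fun s => m s * f s) t).
  assert (CK : forall f, (forall t, continuous f t) -> forall t, continuous (K f) t).
  { intros f Hf t. apply (continuous_minus (fun t => t) (fun t => l * dint (fun s => m s * f s) t)).
    - apply continuous_id.
    - apply (continuous_scal_r l (dint (fun s => m s * f s))). apply continuous_dint, cm, Hf. }
  set (S := fun n => Nat.iter n K (fun t => t)).
  assert (CS : forall n t, continuous (S n) t).
  { induction n as [|n IH]; intros t; [apply continuous_id|]. apply (CK (S n)), IH. }
  (* The summand 1 keeps the weight positive when [l] or [M] is 0. *)
  set (w := 2 * (Rabs l * M) + 1).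
  assert (Hlm : 0 <= Rabs l * M) by (apply Rmult_le_pos; [apply Rabs_pos|apply M_pos]).
  assert (Hw : 0 < w) by (unfold w; lra).
  assert (Hl : Rabs l * M <= w / 2) by (unfold w; lra).
  assert (KL : forall f g C, (forall t, continuous f t) -> (forall t, continuous g t) -> 0 <= C ->
    (forall t, closed01 t -> Rabs (f t - g t) <= C * exp (w * t)) ->
    forall t, closed01 t -> Rabs (K f t - K g t) <= C / 2 * exp (w * t)).
  { intros f g C Hf Hg HC H t Ht. unfold K.
    assert (Cfg : forall t, continuous (fun s => f s - g s) t).
    { intros s. apply (continuous_minus f g); auto. }
    assert (B := dint_contraction (fun s => f s - g s) C w l Hw Hl HC Cfg H t Ht).
    rewrite (dint_linear (fun s => m s * f s) (fun s => m s * g s) _ 1 (-1)) in B; auto.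
    2: intros; ring.
    rewrite <- Rabs_Ropp. eapply Rle_trans; [|eapply Rle_trans; [exact B|]].
    - right. f_equal. ring.
    - destruct Ht. rewrite <- (Rmult_1_l (C / 2 * exp (w * t))) at 2.
      apply Rmult_le_compat_r; [|lra]. pose proof (exp_pos (w * t)). apply Rmult_le_pos; lra. }
  destruct (continuous_bounded (fun t => K (fun t => t) t - t)) as [C0 [HC0 HC]].
  { intros t. apply (continuous_minus (K (fun t => t)) (fun t => t)); [|apply continuous_id].
    apply CK. intros; apply continuous_id. }
  assert (exp_ge : forall t, closed01 t -> 1 <= exp (w * t) <= exp w).
  { intros t [Ht1 Ht2]. split.
    - pose proof (exp_ineq1_le (w * t)). nra.
    - destruct (Req_dec t 1) as [->|]; [rewrite Rmult_1_r; lra|].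
      left. apply exp_increasing. nra. }
  assert (Hd : forall n t, closed01 t -> Rabs (S (Datatypes.S n) t - S n t) <= C0 * (/ 2) ^ n * exp (w * t)).
  { induction n as [|n IH]; intros t Ht.
    - simpl. rewrite Rmult_1_r. specialize (HC t Ht). pose proof (exp_ge t Ht).
      eapply Rle_trans; [exact HC|]. nra.
    - replace (C0 * (/ 2) ^ Datatypes.S n) with (C0 * (/ 2) ^ n / 2) by (simpl; field).
      apply (KL (S (Datatypes.S n)) (S n)); auto.
      apply Rmult_le_pos; [exact HC0|apply pow_le; lra]. }
  (* Geometric tail: [e n - e (n + 1)] bounds the increment from [S n] to its successor, so the
     increments telescope. *)
  set (e := fun n => 2 * C0 * exp w * (/ 2) ^ n).
  assert (He : forall n, 0 <= e n).
  { intros n. unfold e. pose proof (exp_pos w). repeat apply Rmult_le_pos; try lra. apply pow_le; lra. }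
  assert (Hd2 : forall n k t, closed01 t -> Rabs (S (n + k)%nat t - S n t) <= e n - e (n + k)%nat).
  { intros n k t Ht. induction k as [|k IH].
    - rewrite Nat.add_0_r, !Rminus_diag, Rabs_R0. lra.
    - rewrite Nat.add_succ_r. specialize (Hd (n + k)%nat t Ht). destruct (exp_ge t Ht) as [_ Hex].
      replace (S (Datatypes.S (n + k)) t - S n t) with
        ((S (Datatypes.S (n + k)) t - S (n + k)%nat t) + (S (n + k)%nat t - S n t)) by ring.
      eapply Rle_trans; [apply Rabs_triang|].
      assert (C0 * (/ 2) ^ (n + k) * exp (w * t) <= e (n + k)%nat - e (Datatypes.S (n + k))).
      { unfold e. simpl pow. pose proof (pow_le (/ 2) (n + k) ltac:(lra)).
        assert (0 <= C0 * (/ 2) ^ (n + k)) by (apply Rmult_le_pos; lra). nra. }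
      lra. }
  assert (Hlim : is_lim_seq e 0).
  { unfold e. replace (Finite 0) with (Rbar_mult (2 * C0 * exp w) 0) by (simpl; f_equal; ring).
    apply is_lim_seq_scal_l, is_lim_seq_geom. rewrite Rabs_pos_eq; lra. }
  assert (small : forall eps, 0 < eps -> exists N, forall n, (N <= n)%nat -> e n < eps).
  { intros eps Heps. apply is_lim_seq_spec in Hlim. destruct (Hlim (mkposreal eps Heps)) as [N HN].
    exists N. intros n Hn. specialize (HN n Hn). simpl in HN. rewrite Rminus_0_r in HN.
    apply Rabs_def2 in HN. lra. }
  set (z := fun t => real (Lim_seq (fun n => S n t))).
  assert (Hz : forall t, closed01 t -> is_lim_seq (fun n => S n t) (z t)).
  { intros t Ht. apply Lim_seq_correct'. apply ex_lim_seq_cauchy_corr.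
    intros eps. destruct (small (eps / 2)) as [N HN]; [apply is_pos_div_2|].
    exists N. intros n k Hn Hk.
    assert (B : forall j, (N <= j)%nat -> Rabs (S j t - S N t) < eps / 2).
    { intros j Hj. replace j with (N + (j - N))%nat by lia.
      eapply Rle_lt_trans; [apply Hd2, Ht|]. specialize (He (N + (j - N))%nat).
      specialize (HN N (le_n N)). lra. }
    pose proof (B n Hn) as B1. pose proof (B k Hk) as B2.
    apply Rabs_def2 in B1. apply Rabs_def2 in B2. apply Rabs_def1; lra. }
  assert (Hzn : forall n t, closed01 t -> Rabs (z t - S n t) <= e n).
  { intros n t Ht.
    apply (is_lim_seq_le (fun k => Rabs (S (n + k)%nat t - S n t)) (fun _ => e n)
      (Rabs (z t - S n t)) (e n)).
    - intros k. specialize (Hd2 n k t Ht). specialize (He (n + k)%nat). lra.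
    - apply (is_lim_seq_abs _ (z t - S n t)). apply is_lim_seq_minus'; [|apply is_lim_seq_const].
      apply (is_lim_seq_ext (fun k => S (k + n)%nat t)); [intros k; rewrite Nat.add_comm; reflexivity|].
      apply (is_lim_seq_incr_n (fun k => S k t) n), Hz, Ht.
    - apply is_lim_seq_const. }
  set (y := fun t => z (clamp 0 1 t)).
  assert (Ez : forall t, closed01 t -> y t = z t).
  { intros t Ht. unfold y. rewrite clamp_id; auto. }
  assert (Cy : forall t, continuous y t).
  { apply continuous_clamp; [lra|]. intros x Hx eps Heps.
    destruct (small (eps / 3)) as [N HN]; [lra|]. specialize (HN N (le_n N)).
    destruct (proj1 (continuous_eps _ x) (CS N x) (eps / 3)) as [d [Hdp Kd]]; [lra|].
    exists d; split; [exact Hdp|]. intros s Hs Hsx. specialize (Kd s Hsx).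
    assert (K1 := Hzn N x Hx). assert (K2 := Hzn N s Hs).
    apply Rabs_def2 in Kd. apply Rabs_le_between in K1. apply Rabs_le_between in K2.
    apply Rabs_def1; lra. }
  assert (fix_y : forall t, closed01 t -> y t = K y t).
  { intros t Ht. apply Rminus_diag_uniq. apply Rabs_eq_0, Rle_antisym; [|apply Rabs_pos].
    apply le_epsilon. intros eps Heps. rewrite Rplus_0_l.
    pose proof (exp_pos w) as Hew.
    destruct (small (eps / (1 + exp w))) as [N HN]; [apply Rdiv_lt_0_compat; lra|].
    pose proof (HN (Datatypes.S N) ltac:(lia)) as E1. pose proof (HN N (le_n N)) as E2.
    assert (B1 := Hzn (Datatypes.S N) t Ht). rewrite <- Ez in B1 by exact Ht.
    assert (B2 : Rabs (K y t - K (S N) t) <= e N / 2 * exp (w * t)).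
    { apply KL; auto. intros s Hs. rewrite Ez by exact Hs. eapply Rle_trans; [apply Hzn, Hs|].
      specialize (exp_ge s Hs). specialize (He N). nra. }
    change (S (Datatypes.S N) t) with (K (S N) t) in B1.
    destruct (exp_ge t Ht) as [_ Hex]. pose proof (He N).
    assert (B3 : e N / 2 * exp (w * t) <= eps / (1 + exp w) * exp w).
    { pose proof (exp_pos (w * t)). apply Rmult_le_compat; lra. }
    assert (B4 : eps / (1 + exp w) + eps / (1 + exp w) * exp w = eps) by (field; lra).
    apply Rabs_le_between in B1. apply Rabs_le_between in B2. apply Rabs_le; lra. }
  assert (DK : forall t : R, is_derive (K y) t (1 - l * RInt (fun s => m s * y s) 0 t)).
  { intros t. apply (is_derive_minus (fun t => t) (fun t => l * dint (fun s => m s * y s) t)).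
    - apply (is_derive_id t).
    - apply (is_derive_scal (dint (fun s => m s * y s)) t l). exact (proj1 (dint_derive _ (cm y Cy) t)). }
  (* [y] is a clamped function and may have corners at 0 and 1; [K y] agrees with it on [[0,1]] and
     is differentiable on the whole line. *)
  exists (K y). split; [|split].
  - intros t. eapply is_derive_continuous, DK.
  - intros t Ht. assert (CKy : forall t, continuous (K y) t) by (apply CK, Cy).
    unfold K at 1. f_equal. f_equal. symmetry.
    rewrite (dint_linear (fun s => m s * y s) (fun s => m s * y s) (fun s => m s * K y s) 1 0);
      [ring| | | | |exact Ht]; auto.
    intros s Hs. rewrite <- fix_y by exact Hs. ring.
  - exists (fun t => 1 - l * RInt (fun s => m s * y s) 0 t). split.
    + rewrite RInt_at_point. ring.
    + intros t Ht. split; [apply DK|]. rewrite <- fix_y by exact Ht.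
      replace (- (l * (m t * y t))) with (0 - l * (m t * y t)) by ring.
      apply (is_derive_minus (fun _ => 1) (fun t => l * RInt (fun s => m s * y s) 0 t)).
      * apply (is_derive_const 1 t).
      * apply (is_derive_scal (fun t => RInt (fun s => m s * y s) 0 t) t l).
        exact (proj2 (dint_derive _ (cm y Cy) t)).
Qed.

(** The factor [t] is essential: solutions vanish at 0, and positivity near 0 survives a change of
    [l] only if the error vanishes there at the same rate. *)
Lemma ivp_dependence (L : R) : 0 <= L -> exists C, 0 <= C /\
  forall l l' y y', Rabs l <= L -> Rabs l' <= L -> ivp_solution l y -> ivp_solution l' y' ->
  forall t, closed01 t -> Rabs (y t - y' t) <= C * Rabs (l - l') * t.
Proof.
  intros HL. set (w := 2 * (L * M) + 1).
  assert (HLM : 0 <= L * M) by (apply Rmult_le_pos; [exact HL|apply M_pos]).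
  assert (Hw : 0 < w) by (unfold w; lra).
  assert (Hlw : forall l, Rabs l <= L -> Rabs l * M <= w / 2).
  { intros l Hl. unfold w. pose proof M_pos. nra. }
  assert (exp_le : forall t, closed01 t -> exp (w * t) <= exp w).
  { intros t [Ht1 Ht2]. destruct (Req_dec t 1) as [->|]; [rewrite Rmult_1_r; lra|].
    left. apply exp_increasing. nra. }
  set (C1 := 2 * M / w * exp w).
  pose proof (exp_pos w) as Hew. pose proof M_pos as HM0.
  assert (HC1 : 0 <= C1).
  { unfold C1. apply Rmult_le_pos; [|lra]. apply Rdiv_le_0_compat; lra. }
  exists (C1 + C1 * exp w). split.
  { assert (0 <= C1 * exp w) by (apply Rmult_le_pos; lra). lra. }
  intros l l' y y' Hl Hl' [Cy [Ey _]] [Cy' [Ey' _]].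
  assert (Hy' : forall t, closed01 t -> Rabs (y' t) <= 2 * exp (w * t)).
  { intros t Ht. replace 2 with (2 * 1) by ring.
    apply (volterra_bound y' (fun t => t) l' w 1); auto.
    intros s [Hs1 Hs2]. apply Rabs_le; lra. }
  assert (Hdy' : forall t, closed01 t -> Rabs (dint (fun s => m s * y' s) t) <= C1 * t).
  { intros t Ht. eapply Rle_trans.
    - apply (dint_weight_bound y' 2 w Hw); auto; lra.
    - unfold C1. specialize (exp_le t Ht). destruct Ht.
      rewrite (Rmult_comm t). apply Rmult_le_compat_r; [assumption|].
      apply Rmult_le_compat_l; [apply Rdiv_le_0_compat; lra|assumption]. }
  set (D := fun t => y t - y' t).
  assert (CD : forall t, continuous D t) by (intros t; apply (continuous_minus y y'); auto).
  (* The difference solves a Volterra equation with forcing of order [|l - l'| t]; in the final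
     constant [C1] stems from the forcing and [C1 * exp w] from the feedback. *)
  assert (ED : forall t, closed01 t ->
    D t = - (l - l') * dint (fun s => m s * y' s) t - l * dint (fun s => m s * D s) t).
  { intros t Ht. unfold D at 1. rewrite (Ey t Ht), (Ey' t Ht).
    rewrite (dint_linear (fun s => m s * y s) (fun s => m s * y' s) (fun s => m s * D s) 1 (-1)); auto.
    - ring.
    - intros s _. unfold D. ring. }
  pose proof (Rabs_pos (l - l')) as Hll.
  assert (Hp : forall t, closed01 t -> Rabs (- (l - l') * dint (fun s => m s * y' s) t) <= Rabs (l - l') * C1 * t).
  { intros t Ht. rewrite Rabs_mult, Rabs_Ropp, Rmult_assoc. apply Rmult_le_compat_l; auto. }
  assert (HllC : 0 <= Rabs (l - l') * C1) by (apply Rmult_le_pos; assumption).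
  assert (HD : forall t, closed01 t -> Rabs (D t) <= 2 * (Rabs (l - l') * C1) * exp (w * t)).
  { apply (volterra_bound D (fun t => - (l - l') * dint (fun s => m s * y' s) t) l); auto.
    intros t Ht. eapply Rle_trans; [apply Hp, Ht|]. destruct Ht.
    rewrite <- (Rmult_1_r (Rabs (l - l') * C1)) at 2. apply Rmult_le_compat_l; assumption. }
  intros t Ht. change (y t - y' t) with (D t). rewrite (ED t Ht).
  eapply Rle_trans; [apply Rabs_triang|]. rewrite Rabs_Ropp.
  eapply Rle_trans.
  - apply Rplus_le_compat; [apply Hp, Ht|].
    apply (dint_contraction D (2 * (Rabs (l - l') * C1)) w l); auto. lra.
  - specialize (exp_le t Ht). destruct Ht.
    assert (Rabs (l - l') * C1 * t * exp (w * t) <= Rabs (l - l') * C1 * t * exp w).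
    { apply Rmult_le_compat_l; [|assumption]. apply Rmult_le_pos; assumption. }
    lra.
Qed.

End Linear.

(** * Eigenvalues and the positive eigenfunction *)

Lemma solves_eigenvalue (m : R -> R) (l : R) (y : R -> R) :
  (forall t, continuous m t) -> solves y (fun t => l * (m t * y t)) ->
  (exists t, closed01 t /\ y t <> 0) -> is_eigenvalue m l.
Proof.
  intros Hm [Cy [Y0 [Y1 [y1 Hy]]]] Hne.
  exists y, (fun t => - (l * (m t * y t))).
  split; [|split; [|split; [|split; [|split]]]]; auto.
  - intros x _ eps He. destruct (proj1 (continuous_eps y x) (Cy x) eps He) as [d [Hd K]].
    exists d. split; auto.
  - exists y1. intros t Ht. destruct (Hy t (open_closed t Ht)) as [E1 E2].
    split; [exact E1|split; [exact E2|]].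
    apply (continuous_opp (fun t => l * (m t * y t))), (continuous_scal_r l (fun t => m t * y t)).
    apply (continuous_mult m y); auto.
  - intros t _. ring.
Qed.

(* The extension of an eigenfunction that is only [C^2] in the open interval
   satisfies the Volterra equation with the slope at [0] as a free constant. *)
Lemma eigenfunction_volterra (m : R -> R) (l : R) (u u2 : R -> R) :
  (forall t, continuous m t) -> cont_on closed01 u -> C2_open01 u u2 -> u 0 = 0 ->
  (forall t, open01 t -> - u2 t = l * m t * u t) ->
  let v := fun t => u (clamp 0 1 t) in
  (forall t, continuous v t) /\ exists k, forall t, closed01 t ->
    v t = k * t - l * dint (fun s => m s * v s) t.
Proof.
  intros Hm Cu [u1 Hu] U0 Eu v.
  assert (Cv : forall t, continuous v t) by (apply continuous_clamp; [lra|exact Cu]).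
  split; [exact Cv|].
  assert (Cmv : forall t, continuous (fun s => m s * v s) t).
  { intros t. apply (continuous_mult m v); auto. }
  assert (Ev : forall t, closed01 t -> v t = u t).
  { intros t Ht. unfold v. rewrite clamp_id; auto. }
  assert (Dv : forall t, open01 t -> is_derive v t (u1 t)).
  { intros t Ht. apply (is_derive_ext_loc u); [|apply Hu, Ht].
    assert (Hd : 0 < Rmin t (1 - t)) by (destruct Ht; apply Rmin_glb_lt; lra).
    exists (mkposreal _ Hd). intros s Hs. symmetry. apply Ev.
    change (Rabs (s - t) < Rmin t (1 - t)) in Hs. destruct Ht.
    assert (Rabs (s - t) < t) by (eapply Rlt_le_trans; [exact Hs|apply Rmin_l]).
    assert (Rabs (s - t) < 1 - t) by (eapply Rlt_le_trans; [exact Hs|apply Rmin_r]).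
    apply Rabs_def2 in H1. apply Rabs_def2 in H2. unfold closed01. lra. }
  (* [W] has zero second derivative inside, hence constant slope [k]; continuity carries the linear
     formula to the end points. *)
  set (W := fun t => v t + l * dint (fun s => m s * v s) t).
  set (W1 := fun t => u1 t + l * RInt (fun s => m s * v s) 0 t).
  assert (DW : forall t, open01 t -> is_derive W t (W1 t)).
  { intros t Ht. apply (is_derive_plus v (fun t => l * dint (fun s => m s * v s) t)); [apply Dv, Ht|].
    apply (is_derive_scal (dint (fun s => m s * v s)) t l).
    exact (proj1 (dint_derive _ Cmv t)). }
  assert (DW1 : forall t, open01 t -> is_derive W1 t 0).
  { intros t Ht. replace 0 with (u2 t + l * (m t * v t)).
    - apply (is_derive_plus u1 (fun t => l * RInt (fun s => m s * v s) 0 t)); [apply Hu, Ht|].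
      apply (is_derive_scal (fun t => RInt (fun s => m s * v s) 0 t) t l).
      exact (proj2 (dint_derive _ Cmv t)).
    - rewrite Ev by (apply open_closed, Ht). specialize (Eu t Ht). lra. }
  set (k := W1 (1 / 2)).
  assert (Wk : forall t, open01 t -> W1 t = k).
  { intros t [Ht1 Ht2]. unfold k.
    destruct (Rtotal_order t (1 / 2)) as [H|[H|H]]; [|subst; reflexivity|].
    - destruct (MVT_cor2 W1 (fun _ => 0) t (1 / 2) H) as [c [Hc _]].
      { intros c Hc. apply is_derive_Reals, DW1. unfold open01; lra. } lra.
    - destruct (MVT_cor2 W1 (fun _ => 0) (1 / 2) t H) as [c [Hc _]].
      { intros c Hc. apply is_derive_Reals, DW1. unfold open01; lra. } lra. }
  exists k. intros t Ht.
  assert (E : W t - W 0 = k * (t - 0)).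
  { destruct Ht as [Ht1 Ht2].
    destruct (MVT_gen W 0 t (fun _ => k)) as [c [_ Hc]]; [| |exact Hc];
      rewrite Rmin_left, Rmax_right by lra; intros x Hx.
    - rewrite <- (Wk x) by (unfold open01; lra). apply DW. unfold open01; lra.
    - apply continuous_pt.
      apply (continuous_plus v (fun t => l * dint (fun s => m s * v s) t)); [apply Cv|].
      apply (continuous_scal_r l (dint (fun s => m s * v s))), continuous_dint, Cmv. }
  unfold W in E. rewrite dint_0 in E. rewrite (Ev 0), U0 in E by (unfold closed01; lra). lra.
Qed.

(** Decreasing chord slopes of a concave function, with denominators cleared. *)
Lemma concave_slope (y y1 : R -> R) :
  (forall t, closed01 t -> is_derive y t (y1 t)) ->
  (forall s t, closed01 s -> closed01 t -> s <= t -> y1 t <= y1 s) ->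
  forall a b c, 0 <= a -> a < b -> b < c -> c <= 1 ->
  (y c - y b) * (b - a) <= (y b - y a) * (c - b).
Proof.
  intros Hy Hdec a b c Ha Hab Hbc Hc.
  destruct (MVT_cor2 y y1 a b Hab) as [d [Hd1 Hd2]].
  { intros d Hd. apply is_derive_Reals, Hy. unfold closed01; lra. }
  destruct (MVT_cor2 y y1 b c Hbc) as [e [He1 He2]].
  { intros e He. apply is_derive_Reals, Hy. unfold closed01; lra. }
  rewrite Hd1, He1.
  assert (y1 e <= y1 d) by (apply Hdec; unfold closed01; lra).
  replace (y1 d * (b - a) * (c - b)) with (y1 d * ((c - b) * (b - a))) by ring.
  rewrite Rmult_assoc. apply Rmult_le_compat_r; [|assumption].
  apply Rmult_le_pos; lra.
Qed.

Lemma antitone_of_derivative (f f1 : R -> R) :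
  (forall t, closed01 t -> is_derive f t (f1 t)) -> (forall t, closed01 t -> f1 t <= 0) ->
  forall s t, closed01 s -> closed01 t -> s <= t -> f t <= f s.
Proof.
  intros Hf Hn s t [Hs1 Hs2] [Ht1 Ht2] Hst.
  destruct (Req_dec s t) as [->|Hne]; [lra|].
  destruct (MVT_cor2 f f1 s t) as [c [Hc1 Hc2]]; [lra| |].
  { intros c Hc. apply is_derive_Reals, Hf. unfold closed01; lra. }
  specialize (Hn c ltac:(unfold closed01; lra)). nra.
Qed.

(* Continuation in [l]: the first [l] at which the solution of the initial value
   problem stops being positive on (0,1] has a zero at [1], hence is an eigenvalue. *)
Lemma first_eigenfunction_positive (m : R -> R) (M lam1 : R) :
  (forall t, continuous m t) -> (forall t, 0 <= m t <= M) -> 0 < lam1 ->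
  is_first_eigenvalue m lam1 ->
  exists phi, solves phi (fun t => lam1 * (m t * phi t)) /\ forall t, open01 t -> 0 < phi t.
Proof.
  intros Hm HM Hlam [[u [u2 [Cu [C2u [U0 [U1 [Une Eu]]]]]]] Hmin].
  destruct (choice (fun l y => ivp_solution m l y) (ivp_exists m M Hm HM)) as [y Hy].
  assert (Cy : forall l t, continuous (y l) t) by (intros l; apply (Hy l)).
  assert (y_0 : forall l, y l 0 = 0).
  { intros l. destruct (Hy l) as [_ [E _]]. rewrite E by (unfold closed01; lra).
    rewrite dint_0. ring. }
  destruct (ivp_dependence m M Hm HM lam1 (Rlt_le _ _ Hlam)) as [C [HC Hdep]].
  assert (dep : forall l l' t, 0 <= l <= lam1 -> 0 <= l' <= lam1 -> closed01 t ->
    Rabs (y l t - y l' t) <= C * Rabs (l - l') * t).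
  { intros l l' t Hl Hl' Ht. apply Hdep; auto; rewrite Rabs_pos_eq; lra. }
  assert (y_pos_near : forall l, exists s0, 0 < s0 /\ forall s, 0 < s < s0 -> 0 < y l s).
  { intros l. destruct (Hy l) as [_ [_ [y1 [E1 E2]]]].
    destruct (E2 0 ltac:(unfold closed01; lra)) as [E3 _]. rewrite E1 in E3.
    destruct (derive_pos_increasing _ _ _ E3 Rlt_0_1) as [d [Hd K]].
    exists d. split; [exact Hd|]. intros s Hs. specialize (K s).
    rewrite y_0, !Rminus_0_r, Rabs_pos_eq in K by lra. specialize (K Hs). nra. }
  assert (conc : forall l, 0 <= l -> (forall t, closed01 t -> 0 <= y l t) ->
    forall a b c, 0 <= a -> a < b -> b < c -> c <= 1 ->
    (y l c - y l b) * (b - a) <= (y l b - y l a) * (c - b)).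
  { intros l Hl Hpos. destruct (Hy l) as [_ [_ [y1 [_ E2]]]].
    apply (concave_slope (y l) y1); [intros; apply E2; assumption|].
    apply (antitone_of_derivative y1 (fun t => - (l * (m t * y l t)))); [intros; apply E2; assumption|].
    intros t Ht. specialize (Hpos t Ht). specialize (HM t).
    assert (0 <= l * (m t * y l t)); [|lra].
    apply Rmult_le_pos; [exact Hl|]. apply Rmult_le_pos; lra. }
  set (P := fun l => forall t, open01 t -> 0 < y l t).
  (* An interior zero preceded by positive values would, by concavity, force a negative value at
     1. *)
  assert (nonneg_pos : forall l, 0 <= l -> (forall t, closed01 t -> 0 <= y l t) -> P l).
  { intros l Hl Hpos t Ht. pose proof (open_closed t Ht) as Htc. destruct Ht as [Ht1 Ht2].
    destruct (Rle_lt_or_eq_dec 0 (y l t) (Hpos t Htc)) as [Hlt|Heq]; [exact Hlt|exfalso].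
    destruct (y_pos_near l) as [s0 [Hs0 Hs]].
    set (s := Rmin (s0 / 2) (t / 2)).
    assert (Hss : 0 < s < s0 /\ s < t) by (unfold s, Rmin; destruct Rle_dec; lra).
    specialize (Hs s (proj1 Hss)).
    assert (K := conc l Hl Hpos s t 1 ltac:(lra) ltac:(lra) ltac:(lra) ltac:(lra)).
    specialize (Hpos 1 ltac:(unfold closed01; lra)). nra. }
  assert (eig : forall l, 0 <= l -> P l -> y l 1 = 0 ->
    solves (y l) (fun t => l * (m t * y l t)) /\ lam1 <= l).
  { intros l Hl HP H1.
    assert (S : solves (y l) (fun t => l * (m t * y l t))).
    { destruct (Hy l) as [_ [_ [y1 [_ E2]]]].
      split; [apply Cy|split; [apply y_0|split; [exact H1|]]]. exists y1. exact E2. }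
    split; [exact S|]. apply Hmin, (solves_eigenvalue m l (y l) Hm S).
    exists (1 / 2). split; [unfold closed01; lra|].
    apply Rgt_not_eq, HP. unfold open01; lra. }
  (* By uniqueness ([volterra_bound] with [C = 0]) the given eigenfunction is [k * y lam1], and
     [k <> 0] because it is nontrivial. *)
  assert (y_lam1_1 : y lam1 1 = 0).
  { destruct (eigenfunction_volterra m lam1 u u2 Hm Cu C2u U0 Eu) as [Cv [k Ev']].
    set (v := fun t => u (clamp 0 1 t)) in *.
    assert (Ev : forall t, closed01 t -> v t = k * t - lam1 * dint (fun s => m s * v s) t)
      by exact Ev'.
    assert (Evu : forall t, closed01 t -> v t = u t) by (intros t Ht; unfold v; rewrite clamp_id; auto).
    destruct (Hy lam1) as [_ [Ey _]].
    assert (CD : forall t, continuous (fun t => v t - k * y lam1 t) t).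
    { intros t. apply (continuous_minus v (fun t => k * y lam1 t)); [apply Cv|].
      apply (continuous_scal_r k (y lam1)), Cy. }
    assert (cmul : forall f, (forall t, continuous f t) -> forall t, continuous (fun s => m s * f s) t).
    { intros f Hf t. apply (continuous_mult m f); auto. }
    assert (HM0 : 0 <= M) by (specialize (HM 0); lra).
    assert (Z : forall t, closed01 t -> v t - k * y lam1 t = 0).
    { intros t Ht. apply Rabs_eq_0, Rle_antisym; [|apply Rabs_pos].
      replace 0 with (2 * 0 * exp ((2 * (lam1 * M) + 1) * t)) by ring.
      assert (0 <= lam1 * M) by (apply Rmult_le_pos; lra).
      apply (volterra_bound m M Hm HM (fun t => v t - k * y lam1 t) (fun _ => 0) lam1); auto.
      - lra.
      - rewrite Rabs_pos_eq by lra. lra.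
      - intros s Hs. rewrite (Ev s Hs), (Ey s Hs).
        rewrite (dint_linear (fun s => m s * v s) (fun s => m s * y lam1 s)
          (fun s => m s * (v s - k * y lam1 s)) 1 (- k)); auto; [ring|intros; ring].
      - intros s _. rewrite Rabs_R0. lra. }
    assert (k <> 0).
    { intros ->. destruct Une as [t [Ht Hne]]. apply Hne. rewrite <- Evu by exact Ht.
      specialize (Z t Ht). lra. }
    assert (c1 : closed01 1) by (unfold closed01; lra).
    specialize (Z 1 c1). rewrite Evu, U1 in Z by exact c1.
    assert (k * y lam1 1 = 0) by lra. apply Rmult_integral in H0. tauto. }
  set (E := fun l => 0 <= l <= lam1 /\ forall l', 0 <= l' <= l -> P l').
  assert (P0 : P 0).
  { apply nonneg_pos; [lra|]. intros t Ht. destruct (Hy 0) as [_ [E0 _]].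
    rewrite (E0 t Ht). destruct Ht. lra. }
  assert (E0 : E 0).
  { split; [lra|]. intros l' Hl'. replace l' with 0 by lra. exact P0. }
  destruct (completeness E) as [ls [Hub Hlub]].
  { exists lam1. intros l [Hl _]. lra. }
  { exists 0. exact E0. }
  assert (Hls : 0 <= ls <= lam1).
  { split; [apply Hub, E0|]. apply Hlub. intros l [Hl _]. lra. }
  assert (below : forall l, 0 <= l < ls -> P l).
  { intros l Hl. destruct (classic (exists e, E e /\ l < e)) as [[e [[_ He] Hle]]|Hno].
    - apply He. lra.
    - exfalso. assert (ls <= l); [|lra]. apply Hlub. intros e He.
      apply Rnot_lt_le. intros Hle. apply Hno. exists e. auto. }
  (* A negative value at [ls] would persist at [ls - d], where positivity is known. *)
  assert (nonneg : forall t, closed01 t -> 0 <= y ls t).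
  { intros t Ht. apply Rnot_lt_le. intros Hneg.
    destruct (Req_dec ls 0) as [E1|Hne].
    { rewrite E1 in Hneg. destruct (Hy 0) as [_ [E2 _]]. rewrite (E2 t Ht) in Hneg. destruct Ht. lra. }
    set (d := Rmin (ls / 2) (- y ls t / (2 * (C + 1)))).
    assert (Hd : 0 < d).
    { apply Rmin_glb_lt; [lra|]. apply Rdiv_lt_0_compat; lra. }
    assert (Hd1 : d <= ls / 2) by apply Rmin_l.
    assert (Hd2 : d <= - y ls t / (2 * (C + 1))) by apply Rmin_r.
    assert (K := dep (ls - d) ls t ltac:(lra) Hls Ht).
    replace (ls - d - ls) with (- d) in K by ring. rewrite Rabs_Ropp, (Rabs_pos_eq d) in K by lra.
    assert (Cd : (C + 1) * d <= - y ls t / 2).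
    { apply Rmult_le_compat_l with (r := C + 1) in Hd2; [|lra].
      eapply Rle_trans; [exact Hd2|]. right. field. lra. }
    assert (Hy0 : 0 <= y (ls - d) t).
    { destruct (Req_dec t 0) as [->|]; [rewrite y_0; lra|].
      (* [P] says nothing at 1; a negative value there would create a zero inside by the
         intermediate value theorem. *)
      destruct (Req_dec t 1) as [->|].
      - apply Rnot_lt_le. intros Hn.
        assert (Pd : P (ls - d)) by (apply below; lra).
        destruct (IVT_gen (y (ls - d)) (1 / 2) 1 0) as [x [Hx Hx0]].
        + intros x. apply continuous_pt, Cy.
        + specialize (Pd (1 / 2) ltac:(unfold open01; lra)).
          rewrite Rmin_right, Rmax_left by lra. lra.
        + rewrite Rmin_left, Rmax_right in Hx by lra.
          destruct (Req_dec x 1) as [->|]; [lra|].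
          specialize (Pd x ltac:(unfold open01; lra)). lra.
      - left. apply below; [lra|]. destruct Ht. unfold open01. lra. }
    apply Rabs_le_between in K. destruct Ht.
    assert (C * d * t <= C * d) by (assert (0 <= C * d) by (apply Rmult_le_pos; lra); nra).
    lra. }
  assert (Pls := nonneg_pos ls (proj1 Hls) nonneg).
  assert (Els : ls = lam1).
  { destruct (Rle_lt_or_eq_dec 0 (y ls 1) (nonneg 1 ltac:(unfold closed01; lra))) as [H1|H1].
    - apply Rle_antisym; [lra|]. apply Rnot_lt_le. intros Hlt.
      set (k := y ls 1) in *.
      (* Concavity puts [y ls] above its chord. By [ivp_dependence] a shift of [l] by at most [d]
         costs at most [C d t], less than [k t], so positivity would extend beyond the supremum. *)
      assert (lower : forall t, closed01 t -> k * t <= y ls t).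
      { intros t Ht. destruct (Req_dec t 0) as [->|]; [rewrite y_0; lra|].
        destruct (Req_dec t 1) as [->|]; [unfold k; lra|].
        destruct Ht. assert (K := conc ls (proj1 Hls) nonneg 0 t 1 ltac:(lra) ltac:(lra) ltac:(lra) ltac:(lra)).
        rewrite y_0 in K. fold k in K. lra. }
      set (d := Rmin (lam1 - ls) (k / (2 * (C + 1)))).
      assert (Hd : 0 < d).
      { apply Rmin_glb_lt; [lra|]. apply Rdiv_lt_0_compat; lra. }
      assert (Hd1 : d <= lam1 - ls) by apply Rmin_l.
      assert (Hd2 : (C + 1) * d <= k / 2).
      { assert (Hd2 : d <= k / (2 * (C + 1))) by apply Rmin_r.
        apply Rmult_le_compat_l with (r := C + 1) in Hd2; [|lra].
        eapply Rle_trans; [exact Hd2|]. right. field. lra. }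
      assert (E (ls + d)).
      { split; [lra|]. intros l Hl.
        destruct (Rlt_or_le l ls) as [Hll|Hll]; [apply below; lra|].
        intros t Ht. pose proof (open_closed t Ht) as Htc.
        assert (K := dep l ls t ltac:(lra) Hls Htc). rewrite (Rabs_pos_eq (l - ls)) in K by lra.
        specialize (lower t Htc). apply Rabs_le_between in K. destruct Ht.
        assert (C * (l - ls) <= C * d) by (apply Rmult_le_compat_l; lra). nra. }
      specialize (Hub _ H). lra.
    - apply Rle_antisym; [lra|]. apply (eig ls); auto; lra. }
  rewrite Els in Pls. exists (y lam1). split; [|exact Pls].
  apply eig; auto; lra.
Qed.

(** * The strict supersolution *)

(* [1 + sqrt (t (1 - t))] has a second derivative tending to [-oo] at the end points,
   where the margin [(lam1 - lam) m phi] gained from the eigenfunction degenerates. *)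
Lemma barrier (m phi : R -> R) (M lam lam1 : R) :
  (forall t, 0 <= m t <= M) -> 0 < lam < lam1 ->
  solves phi (fun t => lam1 * (m t * phi t)) -> (forall t, open01 t -> 0 < phi t) ->
  exists psi psi1 psi2 eta, 0 < eta /\ (forall t, continuous psi t) /\
    (forall t, closed01 t -> phi t <= psi t) /\
    forall t, open01 t -> is_derive psi t (psi1 t) /\ is_derive psi1 t (psi2 t) /\
      psi2 t + lam * (m t * psi t) <= - eta.
Proof.
  intros Hm [Hl1 Hl2] [Cp [P0 [P1 [p1 Hp]]]] Hpos.
  assert (HM : 0 <= M) by (specialize (Hm 0); lra).
  (* Near the ends the square root must absorb [lam m (2 eps)] and still leave [eps], so
     [1 / (4 s^3) >= k] is wanted; [s <= d = 1 / (2 k)] ensures it. *)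
  set (k := 1 + 2 * (lam * M)).
  assert (HlM : 0 <= lam * M) by (apply Rmult_le_pos; lra).
  assert (Hk : 1 <= k) by (unfold k; lra).
  set (d := / (2 * k)).
  assert (Hd : 0 < d <= 1 / 2).
  { unfold d. split; [apply Rinv_0_lt_compat; lra|].
    replace (1 / 2) with (/ 2) by field. apply Rinv_le_contravar; lra. }
  assert (Hdk : 2 * k * d = 1) by (unfold d; field; lra).
  destruct (continuity_ab_min phi (d * d) (1 - d * d)) as [x [Hx Hxd]]; [nra| |].
  { intros c _. apply continuous_pt, Cp. }
  assert (Hphix : 0 < phi x) by (apply Hpos; unfold open01; nra).
  (* [s t > d] forces [d^2 <= t <= 1 - d^2], where [phi >= phi x]. This [eps] makes [2 lam eps m] at
     most the margin [(lam1 - lam) m phi] there, leaving the square root term to give [-eps] even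
     where [m] vanishes. *)
  set (eps := (lam1 - lam) * phi x / (2 * lam)).
  assert (Heps : 0 < eps).
  { unfold eps. apply Rdiv_lt_0_compat; [apply Rmult_lt_0_compat|]; lra. }
  assert (Heps2 : 2 * lam * eps = (lam1 - lam) * phi x) by (unfold eps; field; lra).
  set (s := fun t => sqrt (t * (1 - t))).
  assert (Cs : forall t, continuous s t).
  { intros t. apply (continuous_comp (fun t => t * (1 - t)) sqrt); [|apply continuous_sqrt].
    apply (is_derive_continuous _ _ (1 - 2 * t)). auto_derive; [exact I|ring]. }
  exists (fun t => phi t + eps * (1 + s t)).
  exists (fun t => p1 t + eps * ((1 - 2 * t) / (2 * s t))).
  exists (fun t => - (lam1 * (m t * phi t)) + eps * (- / (4 * (s t) ^ 3))).
  exists eps. split; [exact Heps|split; [|split]].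
  - intros t. apply (continuous_plus phi (fun t => eps * (1 + s t))); [apply Cp|].
    apply (continuous_scal_r eps (fun t => 1 + s t)).
    apply (continuous_plus (fun _ => 1) s); [apply continuous_const|apply Cs].
  - intros t _. pose proof (sqrt_pos (t * (1 - t))). unfold s. nra.
  - intros t Ht. pose proof (open_closed t Ht) as Htc.
    destruct (Hp t Htc) as [D1 D2]. pose proof Ht as [Ht1 Ht2].
    assert (Hq : 0 < t * (1 - t)) by (apply Rmult_lt_0_compat; lra).
    assert (Hs : 0 < s t) by (apply sqrt_lt_R0, Hq).
    assert (Hss : s t * s t = t * (1 - t)) by (apply sqrt_sqrt; lra).
    assert (Ds : is_derive s t ((1 - 2 * t) / (2 * s t))).
    { unfold s. auto_derive; [exact Hq|]. fold (s t).
      replace (t * (1 + - t)) with (t * (1 - t)) by ring. fold (s t). field. lra. }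
    assert (Ds1 : is_derive (fun t => (1 - 2 * t) / (2 * s t)) t (- / (4 * (s t) ^ 3))).
    { assert (Ds' := Ds). evar_last.
      - apply (is_derive_div (fun t => 1 - 2 * t) (fun t => 2 * s t) t (-2) (2 * ((1 - 2 * t) / (2 * s t)))).
        + auto_derive; [exact I|ring].
        + apply (is_derive_scal s t 2), Ds'.
        + lra.
      - assert (E : (1 - 2 * t) ^ 2 = 1 - 4 * (s t * s t)) by (rewrite Hss; ring).
        transitivity (- (4 * (s t * s t) + (1 - 2 * t) ^ 2) / (4 * s t ^ 3)); [field; lra|].
        rewrite E. field. lra. }
    split; [|split].
    + apply (is_derive_plus phi (fun t => eps * (1 + s t))); [exact D1|].
      apply (is_derive_scal (fun t => 1 + s t) t eps).
      replace ((1 - 2 * t) / (2 * s t)) with (0 + (1 - 2 * t) / (2 * s t)) by ring.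
      apply (is_derive_plus (fun _ => 1) s); [apply (is_derive_const 1 t)|exact Ds].
    + apply (is_derive_plus p1 (fun t => eps * ((1 - 2 * t) / (2 * s t)))); [exact D2|].
      apply (is_derive_scal (fun t => (1 - 2 * t) / (2 * s t)) t eps), Ds1.
    + assert (Hs2 : s t <= 1 / 2).
      { pose proof (Rle_0_sqr (t - 1 / 2)) as Hsq. unfold Rsqr in Hsq.
        apply Rnot_lt_le. intros Hn. nra. }
      assert (Hs3 : 0 < 4 * s t ^ 3) by (pose proof (pow_lt (s t) 3 Hs); lra).
      specialize (Hm t). specialize (Hpos t Ht).
      assert (Hmp : 0 <= m t * phi t) by (apply Rmult_le_pos; lra).
      assert (Hlm : 0 <= lam * m t <= lam * M).
      { split; [apply Rmult_le_pos; lra|apply Rmult_le_compat_l; lra]. }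
      assert (Hes : lam * m t * (eps * (1 + s t)) <= lam * m t * (2 * eps)).
      { apply Rmult_le_compat_l; [lra|nra]. }
      set (a := / (4 * s t ^ 3)).
      assert (Ha : a * (4 * s t ^ 3) = 1) by (unfold a; field; lra).
      assert (Ha0 : 0 < a) by (apply Rinv_0_lt_compat, Hs3).
      destruct (Rle_or_lt (s t) d) as [Hsd|Hsd].
      * assert (Hak : k <= a).
        { apply Rmult_le_reg_r with (4 * s t ^ 3); [exact Hs3|]. rewrite Ha.
          assert (k * s t <= 1 / 2) by nra. simpl. nra. }
        assert (lam * m t * (2 * eps) <= lam * M * (2 * eps)) by (apply Rmult_le_compat_r; lra).
        assert (eps * k <= eps * a) by (apply Rmult_le_compat_l; lra).
        unfold k in H0.
        assert (0 <= (lam1 - lam) * (m t * phi t)) by (apply Rmult_le_pos; lra).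
        lra.
      * assert (Ha1 : 1 <= a).
        { apply Rmult_le_reg_r with (4 * s t ^ 3); [exact Hs3|]. rewrite Ha.
          assert (s t * s t <= 1 / 4) by nra. simpl. nra. }
        assert (phi x <= phi t) by (apply Hx; nra).
        assert (m t * (2 * lam * eps) <= m t * ((lam1 - lam) * phi t)).
        { apply Rmult_le_compat_l; [lra|]. rewrite Heps2. apply Rmult_le_compat_l; lra. }
        assert (eps * 1 <= eps * a) by (apply Rmult_le_compat_l; lra).
        lra.
Qed.

(** * The boundary value problem *)

(** Uniform continuity is Heine's theorem on the rectangle. Boundedness follows from it by walking
    from the origin in finitely many steps, each changing [G] by less than 1. *)
Lemma clamped_regularity (G : R -> R -> R) (B : R) : 0 <= B ->
  (forall x y, continuity_2d_pt G x y) ->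
  (forall t u, G t u = G (clamp 0 1 t) (clamp 0 B u)) ->
  ucont2 G /\ exists K, forall t u, Rabs (G t u) <= K.
Proof.
  intros HB HG E.
  assert (H01 : 0 <= 1) by lra.
  assert (U : ucont2 G).
  { intros eps He.
    destruct (uniform_continuity_2d G 0 1 0 B (fun x y _ _ => HG x y) (mkposreal eps He)) as [d Hd].
    exists d. split; [apply cond_pos|]. intros t s u v Hts Huv. rewrite (E t u), (E s v).
    apply Hd; try (apply clamp_in; assumption).
    - eapply Rle_lt_trans; [apply clamp_lip, H01|exact Hts].
    - eapply Rle_lt_trans; [apply clamp_lip, HB|exact Huv]. }
  split; [exact U|].
  destruct (U 1 Rlt_0_1) as [d [Hd K]].
  assert (step : forall n t u, Rabs t <= INR n * (d / 2) -> Rabs u <= INR n * (d / 2) ->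
    Rabs (G t u - G 0 0) <= INR n).
  { induction n as [|n IH]; intros t u Ht Hu.
    - simpl in *. rewrite Rmult_0_l in *.
      assert (t = 0) by (apply Rabs_eq_0, Rle_antisym; [exact Ht|apply Rabs_pos]).
      assert (u = 0) by (apply Rabs_eq_0, Rle_antisym; [exact Hu|apply Rabs_pos]).
      subst. rewrite Rminus_diag, Rabs_R0. lra.
    - rewrite S_INR in *. pose proof (pos_INR n) as Hn.
      (* Scaling by [th] moves a point of the square of half-side [(n + 1) d / 2] into the preceding
         square by less than [d] in each coordinate. *)
      set (th := INR n / (INR n + 1)).
      assert (A1 : forall z, Rabs z <= (INR n + 1) * (d / 2) -> Rabs (th * z) <= INR n * (d / 2)).
      { intros z Hz. rewrite Rabs_mult, (Rabs_pos_eq th) by (apply Rdiv_le_0_compat; lra).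
        apply Rle_trans with (th * ((INR n + 1) * (d / 2))).
        - apply Rmult_le_compat_l; [apply Rdiv_le_0_compat; lra|exact Hz].
        - right. unfold th. field. lra. }
      assert (A2 : forall z, Rabs z <= (INR n + 1) * (d / 2) -> Rabs (z - th * z) < d).
      { intros z Hz. replace (z - th * z) with (/ (INR n + 1) * z) by (unfold th; field; lra).
        assert (0 < / (INR n + 1)) by (apply Rinv_0_lt_compat; lra).
        rewrite Rabs_mult, (Rabs_pos_eq (/ (INR n + 1))) by lra.
        apply Rle_lt_trans with (/ (INR n + 1) * ((INR n + 1) * (d / 2))).
        - apply Rmult_le_compat_l; lra.
        - rewrite <- Rmult_assoc, Rinv_l by lra. lra. }
      specialize (IH (th * t) (th * u) (A1 t Ht) (A1 u Hu)).
      specialize (K t (th * t) u (th * u) (A2 t Ht) (A2 u Hu)).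
      replace (G t u - G 0 0) with ((G t u - G (th * t) (th * u)) + (G (th * t) (th * u) - G 0 0)) by ring.
      eapply Rle_trans; [apply Rabs_triang|]. lra. }
  destruct (nfloor_ex (Rmax 1 B / (d / 2))) as [n [_ Hn]].
  { apply Rdiv_le_0_compat; [|lra]. apply Rle_trans with 1; [lra|apply Rmax_l]. }
  exists (Rabs (G 0 0) + INR (S n)). intros t u. rewrite (E t u).
  assert (Hn' : Rmax 1 B <= INR (S n) * (d / 2)).
  { rewrite S_INR. left. apply Rlt_div_l; lra. }
  pose proof (Rmax_l 1 B). pose proof (Rmax_r 1 B).
  pose proof (clamp_in 0 1 t H01). pose proof (clamp_in 0 B u HB).
  specialize (step (S n) (clamp 0 1 t) (clamp 0 B u)).
  rewrite !Rabs_pos_eq in step by lra. specialize (step ltac:(lra) ltac:(lra)).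
  replace (G (clamp 0 1 t) (clamp 0 B u)) with
    (G 0 0 + (G (clamp 0 1 t) (clamp 0 B u) - G 0 0)) by ring.
  eapply Rle_trans; [apply Rabs_triang|]. lra.
Qed.

Lemma clamped_product (q : R -> R) (f : R -> R -> R) (B : R) : 0 <= B ->
  cont_on closed01 q -> cont_on2 (fun t u => closed01 t /\ 0 <= u) f ->
  let G := fun t u => q (clamp 0 1 t) * f (clamp 0 1 t) (clamp 0 B u) in
  ucont2 G /\ exists K, forall t u, Rabs (G t u) <= K.
Proof.
  intros HB Hq Hf G. assert (H01 : 0 <= 1) by lra.
  apply (clamped_regularity G B HB).
  - intros x y. apply (continuity_2d_pt_mult (fun t _ => q (clamp 0 1 t))).
    + intros eps.
      destruct (proj1 (continuous_eps (fun t => q (clamp 0 1 t)) x)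
        (continuous_clamp q 0 1 H01 Hq x) eps (cond_pos eps)) as [d [Hd K]].
      exists (mkposreal d Hd). intros u v Hu _. apply K, Hu.
    + intros eps.
      destruct (Hf (clamp 0 1 x) (clamp 0 B y)) with (eps := pos eps) as [d [Hd K]].
      * split; [apply clamp_in, H01|apply clamp_in, HB].
      * apply cond_pos.
      * exists (mkposreal d Hd). intros u v Hu Hv. apply K.
        -- split; [apply clamp_in, H01|apply clamp_in, HB].
        -- eapply Rle_lt_trans; [apply clamp_lip, H01|exact Hu].
        -- eapply Rle_lt_trans; [apply clamp_lip, HB|exact Hv].
  - intros t u. unfold G.
    rewrite (clamp_id 0 1 (clamp 0 1 t)) by (apply clamp_in, H01).
    rewrite (clamp_id 0 B (clamp 0 B u)) by (apply clamp_in, HB). reflexivity.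
Qed.

Lemma is_eigenvalue_ext (m m' : R -> R) (l : R) :
  (forall t, open01 t -> m t = m' t) -> is_eigenvalue m l -> is_eigenvalue m' l.
Proof.
  intros E [u [u2 [H1 [H2 [H3 [H4 [H5 H6]]]]]]]. exists u, u2.
  repeat (split; [assumption|]). intros t Ht. rewrite <- E by exact Ht. auto.
Qed.

Lemma is_first_eigenvalue_ext (m m' : R -> R) (l : R) :
  (forall t, open01 t -> m t = m' t) -> is_first_eigenvalue m l -> is_first_eigenvalue m' l.
Proof.
  intros E [H1 H2]. split; [apply (is_eigenvalue_ext m); assumption|].
  intros mu Hmu. apply H2, (is_eigenvalue_ext m'); [|exact Hmu].
  intros t Ht. symmetry. auto.
Qed.

Lemma positive_solution_exists (q b : R -> R) (f : R -> R -> R) (c delta Rr lam lam1 : R) :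
  cont_on closed01 q -> (forall t, closed01 t -> 0 <= q t) ->
  cont_on2 (fun t u => closed01 t /\ 0 <= u) f ->
  cont_on closed01 b -> (forall t, closed01 t -> 0 <= b t) ->
  0 < delta -> 0 <= Rr ->
  (forall t u, open01 t -> Rr <= u -> f t u <= b t * u) ->
  (forall t u, open01 t -> 0 < u < delta -> c * b t * u <= f t u) ->
  is_first_eigenvalue (fun t => q t * b t) lam1 ->
  0 < lam < lam1 -> lam1 <= lam * c ->
  exists u, positive_solution q f lam u.
Proof.
  intros Cq Hq Cf Cb Hb Hdel HR Hinf H0 Hfirst Hlam Hlamc.
  assert (H01 : 0 <= 1) by lra.
  set (cl := clamp 0 1).
  assert (cl_in : forall t, closed01 (cl t)) by (intros; apply clamp_in, H01).
  assert (cl_id : forall t, closed01 t -> cl t = t) by (intros; apply clamp_id; assumption).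
  set (m := fun t => q (cl t) * b (cl t)).
  assert (Cqc : forall t, continuous (fun t => q (cl t)) t) by (apply continuous_clamp; assumption).
  assert (Cbc : forall t, continuous (fun t => b (cl t)) t) by (apply continuous_clamp; assumption).
  assert (Cm : forall t, continuous m t).
  { intros t. apply (continuous_mult (fun t => q (cl t)) (fun t => b (cl t))); auto. }
  destruct (continuous_bounded m Cm) as [M [HM0 HMb]].
  assert (HM : forall t, 0 <= m t <= M).
  { intros t. split; [apply Rmult_le_pos; auto|].
    specialize (HMb (cl t) (cl_in t)). unfold m in HMb at 1. rewrite (cl_id (cl t)) in HMb by auto.
    apply Rabs_le_between in HMb. apply HMb. }
  assert (Hmf : is_first_eigenvalue m lam1).
  { apply (is_first_eigenvalue_ext (fun t => q t * b t)); [|exact Hfirst].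
    intros t Ht. unfold m. rewrite cl_id by (apply open_closed, Ht). reflexivity. }
  destruct (first_eigenfunction_positive m M lam1 Cm HM ltac:(lra) Hmf) as [phi [Sphi Hphi]].
  destruct (barrier m phi M lam lam1 HM Hlam Sphi Hphi)
    as [psi [psi1 [psi2 [eta [Heta [Cpsi [Hpp Hpsi]]]]]]].
  pose proof Sphi as [Cphi [phi0 [phi_1 [p1 Hp]]]].
  assert (phi_nn : forall t, closed01 t -> 0 <= phi t).
  { intros t [Ht1 Ht2]. destruct (Req_dec t 0) as [->|]; [lra|].
    destruct (Req_dec t 1) as [->|]; [lra|]. left. apply Hphi. unfold open01. lra. }
  destruct (clamped_product q f Rr HR Cq Cf) as [_ [K HK]].
  assert (HK0 : 0 <= K).
  { eapply Rle_trans; [apply Rabs_pos|apply (HK 0 0)]. }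
  (* Hypothesis (i) covers [u >= Rr], the constant [K] the compact range below. *)
  assert (qf_upper : forall t u, open01 t -> 0 <= u -> q t * f t u <= m t * u + K).
  { intros t u Ht Hu. pose proof (open_closed t Ht) as Htc. unfold m. rewrite cl_id by exact Htc.
    destruct (Rle_or_lt Rr u) as [Hru|Hru].
    - specialize (Hinf t u Ht Hru). specialize (Hq t Htc).
      assert (q t * f t u <= q t * (b t * u)) by (apply Rmult_le_compat_l; assumption). lra.
    - specialize (HK t u). fold cl in HK. rewrite (cl_id t Htc), clamp_id in HK by lra.
      apply Rabs_le_between in HK.
      assert (0 <= q t * b t * u) by (apply Rmult_le_pos; [apply Rmult_le_pos|]; auto). lra. }
  (* [A eta] must pay [lam K] from [qf_upper] and the 1 of strictness; [A >= 1] keeps [A psi] above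
     [phi]. *)
  set (A := 1 + (lam * K + 1) / eta).
  assert (HlK : 0 <= lam * K) by (apply Rmult_le_pos; lra).
  assert (HA : 1 <= A).
  { unfold A. assert (0 <= (lam * K + 1) / eta); [|lra]. apply Rdiv_le_0_compat; lra. }
  assert (HAeta : lam * K + 1 <= A * eta).
  { unfold A. replace ((1 + (lam * K + 1) / eta) * eta) with (eta + (lam * K + 1)) by (field; lra). lra. }
  (* Clamping [u] at a bound [B] of the supersolution leaves the nonlinearity unchanged on all
     values that the solution can take. *)
  destruct (continuous_bounded (fun t => A * psi t)) as [B [HB0 HB]].
  { intros t. apply (continuous_scal_r A psi), Cpsi. }
  destruct (clamped_product q f B HB0 Cq Cf) as [HG [KB HKB]].
  set (G := fun t u => q (clamp 0 1 t) * f (clamp 0 1 t) (clamp 0 B u)) in *.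
  assert (HGe : forall t u, closed01 t -> 0 <= u <= B -> G t u = q t * f t u).
  { intros t u Ht Hu. unfold G. fold cl. rewrite (cl_id t Ht), clamp_id by exact Hu. reflexivity. }
  set (F := fun t u => lam * G t u).
  assert (HF : ucont2 F).
  { intros eps He. destruct (HG (eps / lam)) as [d [Hd Kd]]; [apply Rdiv_lt_0_compat; lra|].
    exists d. split; [exact Hd|]. intros t s u v Hts Huv. unfold F.
    rewrite <- Rmult_minus_distr_l, Rabs_mult, (Rabs_pos_eq lam) by lra.
    specialize (Kd t s u v Hts Huv). apply Rmult_lt_compat_l with (r := lam) in Kd; [|lra].
    replace (lam * (eps / lam)) with eps in Kd by (field; lra). exact Kd. }
  assert (HFb : forall t u, Rabs (F t u) <= lam * KB).
  { intros t u. unfold F. rewrite Rabs_mult, (Rabs_pos_eq lam) by lra.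
    apply Rmult_le_compat_l; [lra|apply HKB]. }
  destruct (continuous_bounded phi Cphi) as [Phi [HPhi0 HPhi]].
  (* [e <= 1] orders the pair; the second bound keeps [e phi] below [delta], the range of hypothesis
     (ii). *)
  set (e := Rmin 1 (delta / (2 * (Phi + 1)))).
  assert (He : 0 < e <= 1).
  { unfold e. split; [|apply Rmin_l]. apply Rmin_glb_lt; [lra|]. apply Rdiv_lt_0_compat; lra. }
  assert (Hephi : forall t, closed01 t -> e * phi t < delta).
  { intros t Ht. specialize (HPhi t Ht). specialize (phi_nn t Ht).
    rewrite Rabs_pos_eq in HPhi by exact phi_nn.
    assert (E2 : e <= delta / (2 * (Phi + 1))) by apply Rmin_r.
    apply Rle_lt_trans with (delta / (2 * (Phi + 1)) * (Phi + 1)).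
    - apply Rmult_le_compat; lra.
    - replace (delta / (2 * (Phi + 1)) * (Phi + 1)) with (delta / 2) by (field; lra). lra. }
  assert (order : forall t, closed01 t -> 0 <= e * phi t /\ e * phi t <= A * psi t /\ A * psi t <= B).
  { intros t Ht. specialize (phi_nn t Ht). specialize (Hpp t Ht). specialize (HB t Ht).
    apply Rabs_le_between in HB. split; [apply Rmult_le_pos; lra|]. split; [|apply HB].
    apply Rmult_le_compat; lra. }
  assert (Hsub : subsolution F (fun t => e * phi t)).
  { split; [|split; [|split]]; try (rewrite ?phi0, ?phi_1; lra).
    - intros t. apply (continuous_scal_r e phi), Cphi.
    - exists (fun t => e * p1 t), (fun t => e * - (lam1 * (m t * phi t))).
      intros t Ht. pose proof (open_closed t Ht) as Htc. destruct (Hp t Htc) as [D1 D2].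
      split; [apply (is_derive_scal phi t e), D1|]. split; [apply (is_derive_scal p1 t e), D2|].
      specialize (order t Htc). specialize (Hephi t Htc). specialize (Hphi t Ht).
      unfold F. rewrite HGe by (try assumption; lra).
      assert (He0 : 0 < e * phi t) by (apply Rmult_lt_0_compat; lra).
      specialize (H0 t (e * phi t) Ht (conj He0 Hephi)).
      assert (K1 : q t * (c * b t * (e * phi t)) <= q t * f t (e * phi t)).
      { apply Rmult_le_compat_l; auto. }
      assert (Em : m t = q t * b t) by (unfold m; rewrite cl_id by exact Htc; reflexivity).
      assert (K2 : lam * (q t * (c * b t * (e * phi t))) <= lam * (q t * f t (e * phi t))).
      { apply Rmult_le_compat_l; lra. }
      assert (K3 : lam1 * (m t * (e * phi t)) <= lam * c * (m t * (e * phi t))).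
      { apply Rmult_le_compat_r; [|exact Hlamc]. apply Rmult_le_pos; [apply HM|lra]. }
      rewrite Em in K3 |- *. lra. }
  assert (Hsup : supersolution (fun t u => F t u + 1) (fun t => A * psi t)).
  { split; [|split; [|split]].
    - intros t. apply (continuous_scal_r A psi), Cpsi.
    - pose proof (order 0 ltac:(unfold closed01; lra)). lra.
    - pose proof (order 1 ltac:(unfold closed01; lra)). lra.
    - exists (fun t => A * psi1 t), (fun t => A * psi2 t).
      intros t Ht. pose proof (open_closed t Ht) as Htc. destruct (Hpsi t Ht) as [D1 [D2 D3]].
      split; [apply (is_derive_scal psi t A), D1|]. split; [apply (is_derive_scal psi1 t A), D2|].
      specialize (order t Htc). unfold F. rewrite HGe by (try assumption; lra).
      assert (K1 := qf_upper t (A * psi t) Ht ltac:(lra)).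
      apply Rmult_le_compat_l with (r := lam) in K1; [|lra].
      apply Rmult_le_compat_l with (r := A) in D3; [|lra]. lra. }
  destruct (sub_super_solution F (lam * KB) _ _ HF HFb Hsub Hsup) as [u [Su [Hu1 Hu2]]].
  { intros t Ht. apply order, Ht. }
  pose proof Su as [Cu [u0 [u1 [v1 Hv]]]].
  exists u, (fun t => - F t (u t)).
  split; [|split; [|split; [|split; [|split]]]]; auto.
  - intros x _ eps Heps. destruct (proj1 (continuous_eps u x) (Cu x) eps Heps) as [d [Hd Kd]].
    exists d. split; auto.
  - exists v1. intros t Ht. destruct (Hv t (open_closed t Ht)) as [D1 D2].
    split; [exact D1|split; [exact D2|]].
    apply (continuous_opp (fun t => F t (u t))), ucont2_comp; assumption.
  - intros t Ht. specialize (Hu1 t (open_closed t Ht)). specialize (Hphi t Ht).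
    apply Rlt_le_trans with (2 := Hu1). apply Rmult_lt_0_compat; lra.
  - intros t Ht. pose proof (open_closed t Ht) as Htc.
    specialize (Hu1 t Htc). specialize (Hu2 t Htc). specialize (order t Htc).
    unfold F. rewrite HGe by (try assumption; lra). ring.
Qed.

(** * The coefficients coming from the annulus *)

Lemma cont_on_ex_derive (D : R -> Prop) (g : R -> R) :
  (forall t, D t -> ex_derive g t) -> cont_on D g.
Proof.
  intros H x Hx eps He.
  destruct (proj1 (continuous_eps g x) (ex_derive_continuous g x (H x Hx)) eps He) as [d [Hd K]].
  exists d. split; auto.
Qed.

Lemma pow_lt_strict (r1 r2 : R) (k : nat) : 0 < r1 -> r1 < r2 -> (1 <= k)%nat -> r1 ^ k < r2 ^ k.
Proof.
  intros H1 H2 Hk. rewrite <- !Rpower_pow by lra.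
  apply Rlt_Rpower_l; [apply lt_0_INR; lia|lra].
Qed.

(** With [k = N - 2], the middle term is [B - t] times [r2^k - r1^k]; it interpolates affinely from
    [r2^k] to [r1^k]. *)
Lemma annulus_denominator (r1 r2 t : R) (k : nat) :
  0 < r1 -> r1 < r2 -> (1 <= k)%nat -> closed01 t ->
  0 < r2 ^ k - r1 ^ k /\ 0 < r1 ^ k /\
  r1 ^ k <= r2 ^ k - t * (r2 ^ k - r1 ^ k) <= r2 ^ k.
Proof.
  intros H1 H2 Hk [Ht1 Ht2].
  pose proof (pow_lt_strict r1 r2 k H1 H2 Hk). pose proof (pow_lt r1 k H1). nra.
Qed.

Lemma qfun_regular (N : nat) (r1 r2 : R) : 0 < r1 -> r1 < r2 -> (2 <= N)%nat ->
  cont_on closed01 (qfun N r1 r2) /\ forall t, closed01 t -> 0 <= qfun N r1 r2 t.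
Proof.
  intros H1 H2 HN. unfold qfun. destruct (N =? 2)%nat eqn:EN.
  - split; [|intros t _; apply pow2_ge_0].
    apply cont_on_ex_derive. intros t _. unfold Rpower. auto_derive. exact I.
  - apply Nat.eqb_neq in EN. set (k := (N - 2)%nat). assert (Hk : (1 <= k)%nat) by (unfold k; lia).
    assert (Hk' : 0 < INR k) by (apply lt_0_INR; lia).
    cbv zeta. split.
    + apply cont_on_ex_derive. intros t Ht.
      destruct (annulus_denominator r1 r2 t k H1 H2 Hk Ht) as [Hd [_ [Ht1 _]]].
      pose proof (pow_lt r1 k H1).
      assert (HB : 0 < r2 ^ k / (r2 ^ k - r1 ^ k) - t).
      { replace (r2 ^ k / (r2 ^ k - r1 ^ k) - t) with
          ((r2 ^ k - t * (r2 ^ k - r1 ^ k)) / (r2 ^ k - r1 ^ k)) by (field; lra).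
        apply Rdiv_lt_0_compat; lra. }
      unfold Rpower. set (B := r2 ^ k / (r2 ^ k - r1 ^ k)) in *.
      set (A := (r1 * r2) ^ k / (r2 ^ k - r1 ^ k)).
      auto_derive. repeat split; [exact HB|apply Rgt_not_eq, exp_pos].
    + intros t _. unfold Rdiv at 1. unfold Rpower.
      apply Rmult_le_pos; [apply Rmult_le_pos|]; left; try apply Rinv_0_lt_compat; try apply exp_pos.
      apply pow_lt, Hk'.
Qed.

(** The map [r] is the change of variables back to the radius. Its range matters because [h] is
    controlled on [[r1,r2]] only. *)
Lemma ffun_radius (N : nat) (r1 r2 : R) : 0 < r1 -> r1 < r2 -> (2 <= N)%nat ->
  exists r, cont_on closed01 r /\ (forall t, closed01 t -> r1 <= r t <= r2) /\
    forall h t u, ffun N r1 r2 h t u = h (r t) u.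
Proof.
  intros H1 H2 HN. unfold ffun. destruct (N =? 2)%nat eqn:EN.
  - exists (fun t => r2 * Rpower (r1 / r2) t). split; [|split; [|reflexivity]].
    + apply cont_on_ex_derive. intros t _. unfold Rpower. auto_derive. exact I.
    + intros t [Ht1 Ht2]. unfold Rpower.
      assert (Hln : ln (r1 / r2) < 0).
      { rewrite <- ln_1. apply ln_increasing; [apply Rdiv_lt_0_compat; lra|].
        apply Rlt_div_l; lra. }
      assert (Hmon : forall x y, x <= y -> exp x <= exp y).
      { intros x y [H|H]; [left; apply exp_increasing, H|subst; lra]. }
      split.
      * replace r1 with (r2 * exp (ln (r1 / r2))) at 1.
        -- apply Rmult_le_compat_l; [lra|]. apply Hmon. nra.
        -- rewrite exp_ln by (apply Rdiv_lt_0_compat; lra). field. lra.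
      * apply Rle_trans with (r2 * 1); [|lra]. apply Rmult_le_compat_l; [lra|].
        rewrite <- exp_0. apply Hmon. nra.
  - apply Nat.eqb_neq in EN. set (k := (N - 2)%nat). assert (Hk : (1 <= k)%nat) by (unfold k; lia).
    assert (Hk' : 0 < INR k) by (apply lt_0_INR; lia).
    exists (fun t => Rpower ((r1 * r2) ^ k / (r2 ^ k - r1 ^ k) / (r2 ^ k / (r2 ^ k - r1 ^ k) - t)) (/ INR k)).
    pose proof (pow_lt r1 k H1) as Hp1. pose proof (pow_lt r2 k ltac:(lra)) as Hp2.
    assert (E : forall t, closed01 t ->
      0 < r2 ^ k / (r2 ^ k - r1 ^ k) - t /\
      (r1 * r2) ^ k / (r2 ^ k - r1 ^ k) / (r2 ^ k / (r2 ^ k - r1 ^ k) - t) =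
      r1 ^ k * r2 ^ k / (r2 ^ k - t * (r2 ^ k - r1 ^ k))).
    { intros t Ht. destruct (annulus_denominator r1 r2 t k H1 H2 Hk Ht) as [Hd [_ [Ht1 _]]].
      split.
      - replace (r2 ^ k / (r2 ^ k - r1 ^ k) - t) with
          ((r2 ^ k - t * (r2 ^ k - r1 ^ k)) / (r2 ^ k - r1 ^ k)) by (field; lra).
        apply Rdiv_lt_0_compat; lra.
      - rewrite Rpow_mult_distr. field. repeat split; lra. }
    assert (root : forall r, 0 < r -> Rpower (r ^ k) (/ INR k) = r).
    { intros r Hr. rewrite <- Rpower_pow, Rpower_mult, Rinv_r, Rpower_1; lra. }
    split; [|split; [|reflexivity]].
    + apply cont_on_ex_derive. intros t Ht. destruct (E t Ht) as [HB _].
      destruct (annulus_denominator r1 r2 t k H1 H2 Hk Ht) as [Hd _].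
      unfold Rpower. set (B := r2 ^ k / (r2 ^ k - r1 ^ k)) in *.
      assert (HA : 0 < (r1 * r2) ^ k / (r2 ^ k - r1 ^ k)).
      { apply Rdiv_lt_0_compat; [apply pow_lt, Rmult_lt_0_compat; lra|exact Hd]. }
      set (A := (r1 * r2) ^ k / (r2 ^ k - r1 ^ k)) in *.
      auto_derive. repeat split; [lra|apply Rdiv_lt_0_compat; assumption].
    + intros t Ht. destruct (annulus_denominator r1 r2 t k H1 H2 Hk Ht) as [Hd [_ [Ht1 Ht2]]].
      destruct (E t Ht) as [_ ->].
      (* The [k]-th power of the radius is [r1^k r2^k / z] with [z] between [r1^k] and [r2^k], hence
         lies between the same bounds. *)
      set (z := r2 ^ k - t * (r2 ^ k - r1 ^ k)) in *.
      assert (Hinv : 0 <= / INR k) by (left; apply Rinv_0_lt_compat, Hk').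
      split.
      * rewrite <- (root r1 H1) at 1. apply Rle_Rpower_l; [exact Hinv|]. split; [exact Hp1|].
        apply Rle_div_r; [lra|]. apply Rmult_le_compat_l; lra.
      * rewrite <- (root r2) by lra. apply Rle_Rpower_l; [exact Hinv|].
        rewrite (root r2) by lra. split.
        -- apply Rdiv_lt_0_compat; [apply Rmult_lt_0_compat; lra|lra].
        -- apply Rle_div_l; [lra|]. rewrite Rmult_comm. apply Rmult_le_compat_l; lra.
Qed.

Theorem theorem1p6 (r1 r2 : R) (N : nat) (h : R -> R -> R)
  (b : R -> R) (c delta Rr : R) (lam1 : R) :
  0 < r1 -> r1 < r2 -> (2 <= N)%nat ->
  cont_on2 (fun t u => r1 <= t <= r2 /\ 0 <= u) h ->
  (forall t u, r1 <= t <= r2 -> 0 <= u -> 0 <= h t u) ->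
  (forall t, r1 <= t <= r2 -> h t 0 = 0) ->
  cont_on closed01 b ->
  (forall t, closed01 t -> 0 <= b t) ->
  (exists t, closed01 t /\ b t <> 0) ->
  1 < c -> 0 < delta -> delta < Rr ->
  (forall t u, open01 t -> Rr <= u -> ffun N r1 r2 h t u <= b t * u) ->
  (forall t u, open01 t -> 0 < u < delta -> c * b t * u <= ffun N r1 r2 h t u) ->
  is_first_eigenvalue (fun t => qfun N r1 r2 t * b t) lam1 ->
  forall lam, lam1 / c < lam < lam1 ->
    exists u, positive_solution (qfun N r1 r2) (ffun N r1 r2 h) lam u.
Proof.
  intros Hr1 Hr2 HN Ch _ _ Cb Hb _ Hc Hdel HR Hinf H0 Hfirst lam [Hl1 Hl2].
  destruct (qfun_regular N r1 r2 Hr1 Hr2 HN) as [Cq Hq].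
  destruct (ffun_radius N r1 r2 Hr1 Hr2 HN) as [r [Cr [Hr Ef]]].
  (* Together with [lam < lam1] and [c > 1] this also forces [lam > 0], hence [lam1 > 0]. *)
  assert (Hlc : lam1 < lam * c) by (apply Rlt_div_l in Hl1; lra).
  apply (positive_solution_exists (qfun N r1 r2) b (ffun N r1 r2 h) c delta Rr lam lam1);
    try assumption; try lra; [|nra].
  intros x u [Hx Hu] eps He.
  destruct (Ch (r x) u (conj (Hr x Hx) Hu) eps He) as [d [Hd K]].
  destruct (Cr x Hx d Hd) as [d' [Hd' K']].
  exists (Rmin d d'). split; [apply Rmin_glb_lt; assumption|].
  intros y v [Hy Hv] Hyx Hvu. rewrite !Ef. apply K.
  - split; [apply Hr, Hy|exact Hv].
  - apply K'; [exact Hy|]. eapply Rlt_le_trans; [exact Hyx|apply Rmin_r].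
  - eapply Rlt_le_trans; [exact Hvu|apply Rmin_l].
Qed.
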